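(* Let $k$ be an infinite field with $\operatorname{char}k\ne 2$, and let $G=\langle\tau\rangle\simeq C_2$ act on the rational function field $k(x_1,x_2,x_3,x_4)$ by the $k$-automorphism $$\tau: x_1\mapsto -x_1,\quad x_2\mapsto \frac{x_4}{x_2},\quad x_3\mapsto\frac{-(x_4-1)x_1^2+x_4(x_4-1)}{x_3},\quad x_4\mapsto x_4.$$ Then $k(x_1,x_2,x_3,x_4)^{\langle\tau\rangle}$ is not retract $k$-rational.
   Context: For an infinite field $k$, a field extension $L/k$ is retract $k$-rational if $L$ is the quotient field of a domain $A$ with $k\subset A\subset L$ such that there exist a polynomial ring $k[X_1,\ldots,X_m]$, a nonzero $f\in k[X_1,\ldots,X_m]$ and $k$-algebra morphisms $\varphi:A\to k[X_1,\ldots,X_m][1/f]$, $\psi:k[X_1,\ldots,X_m][1/f]\to A$ with $\psi\circ\varphi=\mathrm{id}_A$. *)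

(* Defs.v *)
From HB Require Import structures.
From mathcomp Require Import all_boot all_order all_algebra.
From mathcomp Require Import boolp classical_sets cardinality.
From mathcomp Require Import mpoly.

Set Implicit Arguments.
Unset Strict Implicit.
Unset Printing Implicit Defensive.

Import GRing.Theory.
Local Open Scope ring_scope.

Notation ratfun k n := {fraction {mpoly k[n]}}.

Definition ratC (k : fieldType) (n : nat) (c : k) : ratfun k n := tofrac c%:MP.
HB.instance Definition _ (k : fieldType) (n : nat) :=
  GRing.RMorphism.copy (@ratC k n) (@tofrac {mpoly k[n]} \o @mpolyC n k).

Definition ratX (k : fieldType) (n : nat) (i : 'I_n) : ratfun k n :=
  tofrac 'X_i.

Section SubringType.
Variables (L : fieldType) (S : subringClosed L).

Record subring_of := SubringOf { subring_val : L; _ : subring_val \in S }.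

HB.instance Definition _ := [isSub for subring_val].
HB.instance Definition _ := [Choice of subring_of by <:].
HB.instance Definition _ :=
  [SubChoice_isSubComNzRing of subring_of by <:].
End SubringType.

Section Localization.
Variables (k : fieldType) (m : nat) (f : {mpoly k[m]}).

Definition mloc_pred : {pred ratfun k m} :=
  fun z => `[< exists (p : {mpoly k[m]}) (n : nat),
                 z = tofrac p / tofrac f ^+ n >].

Fact mloc_subring_closed : subring_closed mloc_pred.
Proof.
split.
- by apply/asboolP; exists 1, 0; rewrite expr0 divr1 rmorph1.
- move=> x y /asboolP[p [n ->]] /asboolP[q [l ->]]; apply/asboolP.
  have [->|f0] := eqVneq f 0.
    rewrite rmorph0; case: n => [|n]; case: l => [|l];
      rewrite ?expr0 ?expr0n /= ?invr0 ?mulr0 ?divr1 ?subr0 ?sub0r.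
    + by exists (p - q), 0; rewrite expr0 divr1 rmorphB.
    + by exists p, 0; rewrite expr0 divr1.
    + by exists (- q), 0; rewrite expr0 divr1 rmorphN.
    + by exists 0, 0; rewrite rmorph0 mul0r.
  exists (p * f ^+ l - q * f ^+ n), (n + l)%N.
  have F0 : tofrac f != 0 by rewrite tofrac_eq0.
  rewrite rmorphB !rmorphM !rmorphXn /= exprD mulrBl invfM.
  congr (_ - _).
    by rewrite mulrCA -mulrA divff ?expf_neq0 // mulr1 mulrC.
  by rewrite -mulrA mulrA mulrA -(mulrA (tofrac q)) divff ?expf_neq0 // mulr1.
- move=> x y /asboolP[p [n ->]] /asboolP[q [l ->]]; apply/asboolP.
  by exists (p * q), (n + l)%N; rewrite rmorphM exprD invfM mulrACA.
Qed.

HB.instance Definition _ :=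
  GRing.isSubringClosed.Build (ratfun k m) mloc_pred mloc_subring_closed.

(* For f != 0 this is the localization k[X_1, ..., X_m][1/f], realized inside
   the rational function field. *)
Definition mloc := subring_of mloc_pred.
HB.instance Definition _ := GRing.ComNzRing.on mloc.
End Localization.

Section FixedField.
Variables (K : fieldType) (tau : {rmorphism K -> K}).

Definition fixed_pred : {pred K} := fun z => tau z == z.

Fact fixed_divring_closed : divring_closed fixed_pred.
Proof.
split; rewrite /in_mem /= /fixed_pred.
- by rewrite rmorph1.
- by move=> x y /eqP hx /eqP hy; rewrite unfold_in rmorphB hx hy.
- by move=> x y /eqP hx /eqP hy; rewrite unfold_in fmorph_div hx hy.
Qed.

HB.instance Definition _ :=
  GRing.isDivringClosed.Build K fixed_pred fixed_divring_closed.

Record fixed_field := FixedField { fixed_val : K; _ : fixed_val \in fixed_pred }.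

HB.instance Definition _ := [isSub for fixed_val].
HB.instance Definition _ := [Choice of fixed_field by <:].
HB.instance Definition _ :=
  [SubChoice_isSubIntegralDomain of fixed_field by <:].
HB.instance Definition _ := [SubIntegralDomain_isSubField of fixed_field by <:].

Variables (k : fieldType) (iota : {rmorphism k -> K}).
Hypothesis iota_fixed : forall c, tau (iota c) = iota c.

Definition fixed_const (c : k) : fixed_field :=
  FixedField (introT eqP (iota_fixed c)).

Fact fixed_const_zmod_morphism : zmod_morphism fixed_const.
Proof. by move=> x y; apply: val_inj; rewrite /= rmorphB. Qed.
Fact fixed_const_monoid_morphism : monoid_morphism fixed_const.
Proof. by split=> [|x y]; apply: val_inj; rewrite /= ?rmorph1 ?rmorphM. Qed.

HB.instance Definition _ :=
  GRing.isZmodMorphism.Build k fixed_field fixed_const fixed_const_zmod_morphism.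
HB.instance Definition _ :=
  GRing.isMonoidMorphism.Build k fixed_field fixed_const
    fixed_const_monoid_morphism.
End FixedField.

(* The extension L/k is given by its structure morphism iota : k -> L. *)
Definition retract_rational (k L : fieldType) (iota : {rmorphism k -> L}) :
    Prop :=
  exists A : subringClosed L,
    [/\ forall c : k, iota c \in A,
        forall z : L, exists a b : L,
          [/\ a \in A, b \in A, b != 0 & z = a / b]
      & exists (m : nat) (f : {mpoly k[m]})
               (phi : {rmorphism subring_of A -> mloc f})
               (psi : {rmorphism mloc f -> subring_of A}),
          [/\ f != 0,
              forall (c : k) (a : subring_of A),
                val a = iota c -> val (phi a) = ratC m c,
              forall (c : k) (b : mloc f),
                val b = ratC m c -> val (psi b) = iota c
            & cancel phi psi]].

(* Main.v *)
Require Import Defs.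
From HB Require Import structures.
From mathcomp Require Import all_boot all_order all_algebra all_field.
From mathcomp Require Import boolp classical_sets cardinality.
From mathcomp Require Import mpoly.
From mathcomp Require Import ring zify.

Set Implicit Arguments.
Unset Strict Implicit.
Unset Printing Implicit Defensive.

Import GRing.Theory.
Local Open Scope ring_scope.

(** Write u = x1^2, t = x4, K = k(x1, ..., x4) and L = K^tau, so K = L(sqrt u).
    In L both t and (t - 1)(t - u) are norms from K, and the obstruction is the
    quaternion algebra (u, t - 1).

    It is unramified as soon as -1 is a square. If L were retract rational, any
    two generic points of L with values in a field F could be joined by a line,
    i.e. by a map L -> F(s) specialising to them at s = 1 and s = 0. An
    unramified quaternion algebra over F(s) is constant (Legendre's descent), so
    (u, t - 1) would split at one of the two points if it splits at the other.

    One of the points is chosen with u a square, so that the algebra splits. The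
    other is the generic point of L after a base change E/k, where a splitting
    means x4 - 1 = z tau(z) with z in E(x1, x4)(x2)(x3). As tau inverts x2 and x3
    up to the factors x4 and (x4 - 1)(x4 - x1^2), comparing coprime numerator
    and denominator of z eliminates x3 and then x2, at the cost of powers of
    these factors; the remaining norm equation over E(x1)(x4) contradicts the
    parity of multiplicities at x4 = 1 and x4 = x1^2. *)

(** * The tame symbol *)

Definition square (K : pzRingType) (c : K) := exists r : K, c = r ^+ 2.

Section Squares.
Variable K : fieldType.
Implicit Types a b : K.

Lemma squareM a b : square a -> square b -> square (a * b).
Proof. by move=> [r ->] [s ->]; exists (r * s); rewrite exprMn. Qed.

Lemma squareX a n : square a -> square (a ^+ n).
Proof. by move=> [r ->]; exists (r ^+ n); rewrite exprAC. Qed.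

Lemma square_sqr a : square (a ^+ 2).
Proof. by exists a. Qed.

Lemma square_even a n : ~~ odd n -> square (a ^+ n).
Proof.
by move=> n2; exists (a ^+ n./2); rewrite -exprM muln2 even_halfK.
Qed.

Lemma square_cancel a b : a != 0 -> square a -> square (a * b) -> square b.
Proof.
move=> a0 [r ar] [s abs]; exists (s / r); have r0 : r != 0.
  by apply: contra_neq a0 => r0; rewrite ar r0 expr0n.
by rewrite expr_div_n -abs ar; field.
Qed.
End Squares.

Section TameSymbol.
Variables (R : idomainType) (kap : fieldType) (pi : {rmorphism R -> kap}).
Variable p : R.
Hypotheses (p_neq0 : p != 0) (pi_p : pi p = 0).
Hypothesis pi_ord : forall a : R, a != 0 ->
  exists n b, a = p ^+ n * b /\ pi b != 0.
Hypothesis sqN1 : square (-1 : kap).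

Lemma ord_uniq n b m c : pi b != 0 -> pi c != 0 ->
  p ^+ n * b = p ^+ m * c -> n = m /\ b = c.
Proof.
wlog nm : n b m c / (n <= m)%N.
  move=> W b0 c0 e; case: (leqP n m) => [h|/ltnW h]; first exact: W.
  by have [-> ->] := W _ _ _ _ h c0 b0 (esym e).
move=> b0 c0; rewrite -(subnKC nm) exprD -mulrA => /mulfI e.
have {}e := e (expf_neq0 _ p_neq0).
case E: (m - n)%N e => [|d].
  by rewrite expr0 mul1r addn0.
by move=> e; move: b0; rewrite e rmorphM rmorphXn pi_p expr0n mul0r eqxx.
Qed.

(* The usual sign of the tame symbol is dropped because -1 is a square. *)
Definition tame (U V : R) := exists v u w x,
  [/\ U = p ^+ v * u, V = p ^+ w * x, pi u != 0, pi x != 0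
    & square (pi u ^+ w * pi x ^+ v)].

Lemma tameI v u w x : pi u != 0 -> pi x != 0 ->
  square (pi u ^+ w * pi x ^+ v) -> tame (p ^+ v * u) (p ^+ w * x).
Proof. by move=> u0 x0 h; exists v, u, w, x. Qed.

Lemma tame_square v u w x : pi u != 0 -> pi x != 0 ->
  tame (p ^+ v * u) (p ^+ w * x) -> square (pi u ^+ w * pi x ^+ v).
Proof.
move=> u0 x0 [v' [u' [w' [x' [eU eV u0' x0' h]]]]].
have [-> ->] := ord_uniq u0 u0' eU.
by have [-> ->] := ord_uniq x0 x0' eV.
Qed.

Lemma tameC U V : tame U V -> tame V U.
Proof.
move=> [v [u [w [x [-> -> u0 x0 h]]]]].
by exists w, x, v, u; split=> //; rewrite mulrC.
Qed.

Lemma tameM U V W : tame U V -> tame U W -> tame U (V * W).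
Proof.
move=> [v [u [w [x [eU -> u0 x0 h]]]]] [v' [u' [w' [x' [eU' -> u0' x0' h']]]]].
have e := eU; rewrite eU' in e; have [ev eu] := ord_uniq u0' u0 e; subst.
exists v, u, (w + w')%N, (x * x'); split=> //; first by rewrite exprD; ring.
  by rewrite rmorphM mulf_neq0.
by rewrite exprD rmorphM exprMn mulrACA; apply: squareM.
Qed.

Lemma tame_cancel U V W : W != 0 -> tame U V -> tame U (V * W) -> tame U W.
Proof.
move=> /pi_ord[w' [x' [-> x0']]] [v [u [w [x [-> -> u0 x0 h]]]]].
rewrite mulrACA -exprD => /tame_square h'.
apply: tameI => //; apply: (square_cancel _ h); first by rewrite mulf_neq0 ?expf_neq0.
by move: h'; rewrite rmorphM mulf_neq0 // => /(_ u0 isT); rewrite exprD exprMn mulrACA.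
Qed.

Lemma tame_even v u w x : ~~ odd v -> ~~ odd w -> pi u != 0 -> pi x != 0 ->
  tame (p ^+ v * u) (p ^+ w * x).
Proof.
by move=> v2 w2 u0 x0; apply: tameI => //; apply: squareM; exact: square_even.
Qed.

Lemma tame_sqr U D : U != 0 -> D != 0 -> tame U (D ^+ 2).
Proof.
move=> /pi_ord[v [u [-> u0]]] /pi_ord[w [x [-> x0]]].
rewrite exprMn -exprM; apply: tameI; rewrite ?rmorphXn ?expf_neq0 //.
apply: squareM; first by apply: square_even; rewrite oddM andbF.
by rewrite exprAC; exact: square_sqr.
Qed.

Lemma tameN U V : tame U V -> tame U (- V).
Proof.
move=> [v [u [w [x [-> -> u0 x0 h]]]]].
rewrite -mulrN; apply: tameI; rewrite ?rmorphN ?oppr_eq0 //.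
rewrite -mulN1r exprMn mulrCA; apply: squareM => //; exact: squareX.
Qed.

Lemma tame_self U : U != 0 -> tame U U.
Proof.
move=> /pi_ord[v [u [-> u0]]]; apply: tameI => //; exact: square_sqr.
Qed.

(** Only the order of the second entry and the residue of its unit part enter the symbol. *)
Lemma tame_lead U w x x' : pi x != 0 -> pi x = pi x' ->
  tame U (p ^+ w * x) -> tame U (p ^+ w * x').
Proof.
move=> x0 e [v [u [w' [y [eU eV u0 y0 h]]]]].
have [ew ey] := ord_uniq x0 y0 eV; subst.
by rewrite e in h x0; exists v, u, w', x'.
Qed.

Lemma tame_lead_sub U w x w' y : (w < w')%N -> pi x != 0 ->
  tame U (p ^+ w * x) -> tame U (p ^+ w * x - p ^+ w' * y).
Proof.
move=> ww x0 h; have -> : p ^+ w * x - p ^+ w' * y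
    = p ^+ w * (x - p ^+ (w' - w).-1.+1 * y).
  by rewrite prednK ?subn_gt0 // -{1}(subnKC (ltnW ww)) exprD; ring.
apply: tame_lead h => //.
by rewrite rmorphB rmorphM rmorphXn pi_p expr0n mul0r subr0.
Qed.

(** The orders of [a ^+ 2] and [U * b ^+ 2] are compared. If they differ, the term of lower order
    decides, and each term is tame with [U]. If they agree, the order of [U] is even, and a
    cancellation of residues forces [pi u] to be a square. *)
Lemma tame_norm U V a b : U != 0 -> V != 0 -> V = a ^+ 2 - U * b ^+ 2 ->
  tame U V.
Proof.
move=> U0 V0 eV.
have [a0|a0] := eqVneq a 0.
  have b0 : b != 0 by apply: contra_neq V0 => b0; rewrite eV a0 b0; ring.
  rewrite eV a0 expr0n sub0r; apply: tameN; apply: tameM; first exact: tame_self.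
  exact: tame_sqr.
have [b0|b0] := eqVneq b 0.
  by rewrite eV b0 expr0n mulr0 subr0; apply: tame_sqr.
have TA := tame_sqr U0 a0; have TB := tameM (tame_self U0) (tame_sqr U0 b0).
have [v [u [eU u0]]] := pi_ord U0.
have [n [a' [ea a0']]] := pi_ord a0; have [m [b' [eb b0']]] := pi_ord b0.
have ea2 : a ^+ 2 = p ^+ (n * 2) * a' ^+ 2 by rewrite ea exprMn exprM.
have eb2 : U * b ^+ 2 = p ^+ (v + m * 2) * (u * b' ^+ 2).
  by rewrite eb eU exprMn exprD exprM; ring.
have a20 : pi (a' ^+ 2) != 0 by rewrite rmorphXn expf_neq0.
have b20 : pi (u * b' ^+ 2) != 0 by rewrite rmorphM rmorphXn mulf_neq0 ?expf_neq0.
rewrite ea2 in TA; rewrite eb2 in TB; rewrite eV ea2 eb2.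
case: (ltngtP (n * 2) (v + m * 2)) => nm.
- exact: tame_lead_sub.
- by rewrite -opprB; apply: tameN; apply: tame_lead_sub.
have v2 : ~~ odd v by have := congr1 odd nm; rewrite oddD !oddM !andbF addbF => <-.
rewrite -nm -mulrBr; have [c0|c0] := eqVneq (pi (a' ^+ 2 - u * b' ^+ 2)) 0; last first.
  by rewrite eU; apply: tame_even => //; rewrite oddM andbF.
have su : square (pi u).
  exists (pi a' / pi b'); rewrite expr_div_n.
  move/eqP: c0; rewrite rmorphB subr_eq0 rmorphXn rmorphM rmorphXn => /eqP ->.
  by rewrite mulfK ?expf_neq0.
have [w [x [eVx x0]]] := pi_ord V0.
rewrite mulrBr {2}nm -ea2 -eb2 -eV eU eVx; apply: tameI => //.
by apply: squareM; [exact: squareX|exact: square_even].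
Qed.

(* If T and (T - D^2)(T - U) are norms from the extension by the square root
   of U, then (U, T - D^2) is unramified at p. *)
Lemma tame_difference U T D : U != 0 -> T != 0 -> D != 0 -> T - D ^+ 2 != 0 ->
  T - U != 0 -> tame U T -> tame U ((T - U) * (T - D ^+ 2)) ->
  tame U (T - D ^+ 2).
Proof.
move=> U0 T0 D0 V0 TU0 hT hTV; have C := tame_cancel V0 _ hTV.
have hD := tame_sqr U0 D0; have hU := tame_self U0.
have [v [u [eU u0]]] := pi_ord U0; have [n [x [eT x0]]] := pi_ord T0.
have [m [d [eD d0]]] := pi_ord D0.
have eD2 : D ^+ 2 = p ^+ (m * 2) * d ^+ 2 by rewrite eD exprMn exprM.
have d20 : pi (d ^+ 2) != 0 by rewrite rmorphXn expf_neq0.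
(* If [T] and [D ^+ 2] have different orders, the dominant one decides. *)
case: (ltngtP n (m * 2)) => nm.
- by rewrite eD2 eT; apply: tame_lead_sub => //; rewrite -eT.
- by rewrite -opprB; apply: tameN; rewrite eT eD2; apply: tame_lead_sub; rewrite -?eD2.
(* Now [T] and [D ^+ 2] have the same order. If that of [U] differs, [T - U] is tame with [U], and
   [C] passes this on to the cofactor [T - D ^+ 2]. *)
case: (ltngtP v n) => vn.
- by apply: C; rewrite -opprB; apply: tameN; rewrite {2}eU eT; apply: tame_lead_sub; rewrite -?eU.
- by apply: C; rewrite {2}eU eT; apply: tame_lead_sub; rewrite -?eT.
have n2 : ~~ odd n by rewrite nm oddM andbF.
have eTU : T - U = p ^+ n * (x - u) by rewrite eT eU vn; ring.
have [xu|xu] := eqVneq (pi (x - u)) 0; last first.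
  by apply: C; rewrite eTU eU vn; apply: tame_even.
have eV : T - D ^+ 2 = p ^+ n * (x - d ^+ 2) by rewrite eT eD2 nm; ring.
have [xd|xd] := eqVneq (pi (x - d ^+ 2)) 0; last first.
  by rewrite eV eU vn; apply: tame_even.
(* Both differences have residue zero, so [pi u], [pi x] and [pi d ^+ 2] coincide. *)
have su : square (pi u).
  exists (pi d); move/eqP: xd; move/eqP: xu.
  by rewrite !rmorphB !subr_eq0 rmorphXn => /eqP -> /eqP.
have [w [y [-> y0]]] := pi_ord V0.
rewrite eU; apply: tameI => //.
by apply: squareM; [exact: squareX|apply: square_even; rewrite vn].
Qed.

End TameSymbol.

(** * Unramified quaternion algebras over F(s) *)

(* The squares of the pure quaternions of the quaternion algebra (u, v). *)
Definition rep (E : fieldType) (u v w : E) :=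
  exists x y z, w = u * x ^+ 2 + v * y ^+ 2 - u * v * z ^+ 2.

Section Represented.
Variable E : fieldType.
Implicit Types u v w : E.

Lemma repC u v w : rep u v w -> rep v u w.
Proof. by move=> [x [y [z ->]]]; exists y, x, z; ring. Qed.

(** The new coordinates are those of the product of [a + b * sqrt u] and [y + z * sqrt u], divided
    by [v']; the norm is multiplicative. *)
Lemma rep_norm u v v' a b w : v != 0 -> v' != 0 -> v * v' = a ^+ 2 - u * b ^+ 2 ->
  rep u v w -> rep u v' w.
Proof.
move=> v0 v0' e [x [y [z ->]]].
exists x, ((a * y + u * b * z) / v'), ((a * z + b * y) / v').
have ve : v = (a ^+ 2 - u * b ^+ 2) / v' by rewrite -e mulfK.
by rewrite ve; field.
Qed.

Lemma rep_sqr u v g w : g != 0 -> rep u (v * g ^+ 2) w <-> rep u v w.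
Proof.
move=> g0; split=> -[x [y [z ->]]].
  by exists x, (g * y), (g * z); ring.
by exists x, (y / g), (z / g); field.
Qed.

Lemma rep1_sqr r v : r != 0 -> rep (r ^+ 2) v 1.
Proof. by move=> r0; exists r^-1, 0, 0; field. Qed.
End Represented.

Section Unramified.
Variable F : fieldType.
Hypothesis sqN1 : square (-1 : F).
Implicit Types U V W T D p q : {poly F}.

(* [size_mul] with the size instances syntactically those of [F], for [lia]. *)
Lemma size_mulF p q : p != 0 -> q != 0 -> size (p * q) = (size p + size q).-1.
Proof. exact: size_mul. Qed.

(** The residue field arises by adjoining a root of [p], with [pi] the evaluation there; a Bezout
    relation shows that [pi] kills only multiples of [p]. *)
Lemma residue_field p : irreducible_poly p ->
  exists (kap : fieldType) (pi : {rmorphism {poly F} -> kap}),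
    (forall c, exists q, pi q = c) /\ forall q, (pi q == 0) = (p %| q).
Proof.
move=> irr; have [L _ [z pz genz]] := irredp_FAdjoin irr.
have [pi piE] : exists pi : {rmorphism {poly F} -> L},
    forall q, pi q = (map_poly (in_alg L) q).[z].
  by exists (horner_alg z).
exists L, pi.
have pip : pi p = 0 by apply/eqP; rewrite piE -rootE.
split=> [c|q].
  have : c \in <<1; z>>%VS by rewrite genz memvf.
  by case/Fadjoin_polyP=> _ /polyOver1P[q ->] ->; exists q; rewrite piE.
apply/idP/idP; last by move=> /dvdpP[r ->]; rewrite rmorphM pip mulr0.
move=> /eqP q0; apply/idPn; rewrite -irreducible_poly_coprime //.
move=> /Bezout_eq1_coprimepP[[a b] /= /(congr1 pi)].
rewrite rmorphD !rmorphM pip q0 rmorph1 !mulr0 addr0 => /esym/eqP.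
by rewrite oner_eq0.
Qed.

Lemma poly_ord p U : (1 < size p)%N -> U != 0 ->
  exists n V, U = p ^+ n * V /\ ~~ (p %| V).
Proof.
move=> p1; elim: {U}(size U) {-2}U (leqnn (size U)) => [|s IH] U sU U0.
  by move: U0; rewrite -size_poly_eq0 -leqn0 sU.
have [/dvdpP[V eU]|] := boolP (p %| U); last by exists 0%N, U; rewrite mul1r.
have V0 : V != 0 by apply: contra_neq U0 => V0; rewrite eU V0 mul0r.
have [|n [W [eV pW]]] := IH V _ V0; last first.
  by exists n.+1, W; split=> //; rewrite eU eV exprSr; ring.
have p0 : p != 0 by rewrite -size_poly_gt0 ltnW.
by move: sU; rewrite eU size_mulF //; lia.
Qed.

Lemma irreducible_factor U : (1 < size U)%N ->
  exists p, irreducible_poly p /\ p %| U.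
Proof.
elim: {U}(size U) {-2}U (leqnn (size U)) => [|s IH] U sU U1; first lia.
have [irr|] := pselect (irreducible_poly U); first by exists U.
move=> nirr; suff [q [q1 qU sq]] : exists q, [/\ (1 < size q)%N, q %| U & (size q < size U)%N].
  have [|p [ip pq]] := IH q _ q1; first lia.
  by exists p; split=> //; apply: dvdp_trans qU.
apply: contrapT => H; apply: nirr; split=> // q q1 qU.
have U0 : U != 0 by rewrite -size_poly_gt0 ltnW.
have := dvdp_leq U0 qU; rewrite leq_eqVlt => /orP[/eqP sq|sq].
  by rewrite -dvdp_size_eqp // sq.
case: H; exists q; split=> //; have : q != 0 by apply: contraTneq qU => ->; rewrite dvd0p.
by rewrite -size_poly_gt0 => q0; rewrite ltn_neqAle eq_sym q0 andbT.
Qed.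

(** The places are the closed points of the affine line. Any map with kernel generated by [p] serves
    as residue map, so no residue field has to be fixed. *)
Definition unram U V := forall p (kap : fieldType)
  (pi : {rmorphism {poly F} -> kap}),
  irreducible_poly p -> (forall q, (pi q == 0) = (p %| q)) -> tame pi p U V.

Section Local.
Variables (p : {poly F}) (kap : fieldType) (pi : {rmorphism {poly F} -> kap}).
Hypotheses (irr : irreducible_poly p) (pi0 : forall q, (pi q == 0) = (p %| q)).

Lemma local_p_neq0 : p != 0. Proof. exact: irredp_neq0. Qed.
Lemma local_pi_p : pi p = 0. Proof. by apply/eqP; rewrite pi0. Qed.
Lemma local_ord (a : {poly F}) : a != 0 ->
  exists n b, a = p ^+ n * b /\ pi b != 0.
Proof.
move=> /(poly_ord irr.1) [n [b [-> pb]]].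
by exists n, b; rewrite pi0.
Qed.
Lemma local_sqN1 : square (-1 : kap).
Proof.
have [i ei] := sqN1; exists (pi i%:P).
by rewrite -rmorphXn -polyC_exp -ei rmorphN rmorph1 rmorphN1.
Qed.
End Local.

Lemma unramC U V : unram U V -> unram V U.
Proof. by move=> h p kap pi ip pi0; apply: tameC; apply: h. Qed.

Lemma unram_cancel U V W : W != 0 -> unram U V -> unram U (V * W) -> unram U W.
Proof.
move=> W0 h h' p kap pi ip pi0.
apply: (tame_cancel (local_p_neq0 ip) (local_pi_p pi0) (local_ord ip pi0) W0).
  exact: h.
exact: h'.
Qed.

Lemma unram_norm U V a b : U != 0 -> V != 0 -> V = a ^+ 2 - U * b ^+ 2 -> unram U V.
Proof.
move=> U0 V0 e p kap pi ip pi0.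
by apply: (tame_norm (local_p_neq0 ip) (local_pi_p pi0) (local_ord ip pi0) (local_sqN1 pi) _ _ e).
Qed.

Lemma unram_sqr U D : U != 0 -> D != 0 -> unram U (D ^+ 2).
Proof.
by move=> U0 D0; apply: (@unram_norm _ _ D 0); rewrite ?expf_neq0 //; ring.
Qed.

Lemma unram_difference U T D : U != 0 -> T != 0 -> D != 0 ->
  T - D ^+ 2 != 0 -> T - U != 0 -> unram U T ->
  unram U ((T - U) * (T - D ^+ 2)) -> unram U (T - D ^+ 2).
Proof.
move=> U0 T0 D0 V0 TU0 h h' p kap pi ip pi0.
apply: (tame_difference (local_p_neq0 ip) (local_pi_p pi0) (local_ord ip pi0) (local_sqN1 pi)) => //.
  exact: h.
exact: h'.
Qed.

(** At a prime dividing [V] exactly once and not dividing [U], the tame symbol is the residue of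
    [U]; a square root of it lifts because [pi] is surjective. *)
Lemma square_mod_prime U V p : irreducible_poly p -> U != 0 -> V != 0 ->
  unram U V -> p %| V -> ~~ (p ^+ 2 %| V) -> exists r, p %| U - r ^+ 2.
Proof.
move=> ip U0 V0 h /dvdpP[W eV] p2; have [kap [pi [pi_surj pi0]]] := residue_field ip.
have [pU|pU] := boolP (p %| U); first by exists 0; rewrite expr0n subr0.
have pW : ~~ (p %| W).
  by apply: contra p2 => /dvdpP[X eX]; apply/dvdpP; exists X; rewrite eV eX; ring.
have := h p kap pi ip pi0.
have -> : U = p ^+ 0 * U by rewrite mul1r.
have -> : V = p ^+ 1 * W by rewrite eV mulrC.
move=> /(tame_square (local_p_neq0 ip) (local_pi_p pi0)); rewrite !pi0.
move=> /(_ pU pW) [r]; rewrite !expr0 expr1 mulr1 mul1r => er.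
by have [q eq] := pi_surj r; exists q; rewrite -pi0 rmorphB rmorphXn eq er subrr.
Qed.

(** Chinese remainder theorem, splitting off one prime factor of [V] at a time. *)
Lemma square_mod_squarefree U V : V != 0 ->
  (forall p, irreducible_poly p -> ~~ (p ^+ 2 %| V)) ->
  (forall p, irreducible_poly p -> p %| V -> exists r, p %| U - r ^+ 2) ->
  exists r, V %| U - r ^+ 2.
Proof.
elim: {V}(size V) {-2}V (leqnn (size V)) => [|s IH] V sV V0 sf hp.
  by move: V0; rewrite -size_poly_eq0 -leqn0 sV.
have [V1|V1] := leqP (size V) 1.
  have e : V %= 1 by rewrite -size_poly_eq1 eqn_leq V1 size_poly_gt0.
  by exists 0; rewrite (eqp_dvdl _ e) dvd1p.
have [p [ip /dvdpP[W eV]]] := irreducible_factor V1.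
have W0 : W != 0 by apply: contra_neq V0 => W0; rewrite eV W0 mul0r.
have [|q iq|q iq|r rW] := IH W _ W0.
- have p1 : (1 < size p)%N := ip.1.
  by move: sV; rewrite eV (size_mulF W0 (irredp_neq0 ip)); lia.
- by apply: contra (sf q iq) => qW; rewrite eV dvdp_mulr.
- by move=> qW; apply: hp; rewrite // eV dvdp_mulr.
have [r' rp] : exists r', p %| U - r' ^+ 2 by apply: hp; rewrite // eV dvdp_mull.
have pW : coprimep p W.
  rewrite irreducible_poly_coprime //; apply: contra (sf p ip) => /dvdpP[X eX].
  by apply/dvdpP; exists X; rewrite eV eX; ring.
have /Bezout_eq1_coprimepP [[a b] /= e] := pW.
(* By the Bezout relation [a * p + b * W = 1], [t] is congruent to [r'] modulo [p] and to [r] modulo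
   [W]. *)
pose t := r' * b * W + r * a * p.
have sqB x : U - t ^+ 2 = (U - x ^+ 2) + (x - t) * (x + t) by ring.
have tp : r' - t = p * (a * (r' - r)) by rewrite -{1}[r']mulr1 -e /t; ring.
have tW : r - t = W * (b * (r - r')) by rewrite -{1}[r]mulr1 -e /t; ring.
exists t; rewrite eV mulrC Gauss_dvdp //; apply/andP; split.
  by rewrite (sqB r') tp -mulrA dvdp_addr ?dvdp_mulr.
by rewrite (sqB r) tW -mulrA dvdp_addr ?dvdp_mulr.
Qed.

(* Legendre's descent: as V divides r^2 - U, the entry V may be replaced by
   (r^2 - U) / V, of smaller degree. *)
Lemma unram_constant U V : U != 0 -> V != 0 -> unram U V ->
  rep (tofrac U) (tofrac V) 1 \/
  exists c d : F, [/\ c != 0, d != 0 & forall w,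
    rep (tofrac U) (tofrac V) w <-> rep (tofrac c%:P) (tofrac d%:P) w].
Proof.
move: {2}(size U + size V)%N (leqnn (size U + size V)) => n.
elim: n U V => [|n IH] U V sUV U0 V0 h.
  by move: U0; rewrite -size_poly_gt0; lia.
wlog sle : U V sUV U0 V0 h / (size U <= size V)%N.
  move=> W; have [le|/ltnW le] := leqP (size U) (size V); first exact: W.
  have [|/repC|[c [d [c0 d0 e]]]] := W V U _ V0 U0 (unramC h) le; first by rewrite addnC.
    by left.
  by right; exists c, d; split=> // w; split=> [/repC/e//|/e/repC].
have [V1|V1] := leqP (size V) 1.
  right; have eU := size1_polyC (leq_trans sle V1); have eV := size1_polyC V1.
  by exists U`_0, V`_0; rewrite -eU -eV -!(polyC_eq0 _`_0) -eU -eV; split.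
(* A square factor of [V] changes neither the algebra nor its ramification, so it is removed. *)
have [[p [ip /dvdpP[W eV]]]|sf] := pselect (exists p, irreducible_poly p /\ p ^+ 2 %| V).
  have p0 := irredp_neq0 ip; have p1 : (1 < size p)%N := ip.1.
  have W0 : W != 0 by apply: contra_neq V0 => W0; rewrite eV W0 mul0r.
  have repV w : rep (tofrac U) (tofrac V) w <-> rep (tofrac U) (tofrac W) w.
    by rewrite eV rmorphM rmorphXn; apply: rep_sqr; rewrite tofrac_eq0.
  have [||/repV|[c [d [c0 d0 e]]]] := IH U W _ U0 W0.
  - move: sUV; rewrite eV expr2 !size_mulF ?mulf_neq0 //.
    by move: W0; rewrite -size_poly_gt0; lia.
  - apply: unram_cancel (unram_sqr U0 p0) _ => //.
    by rewrite mulrC -eV.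
  - by left.
  - by right; exists c, d; split=> // w; split=> [/repV/e//|/e/repV].
have [|p ip pV|r rV] := @square_mod_squarefree U V V0.
- by move=> p ip; apply/negP => pV; case: sf; exists p.
- apply: square_mod_prime h pV _ => //.
  by apply/negP => p2V; case: sf; exists p.
(* Reducing [r] modulo [V] keeps the degree of [r ^+ 2 - U] small enough for the cofactor to have
   smaller degree than [V]. *)
wlog sr : r rV / (size r < size V)%N.
  move=> W; apply: (W (r %% V)); last by rewrite ltn_modp.
  have -> : U - (r %% V) ^+ 2 = (U - r ^+ 2) + V * ((r %/ V) * (r + r %% V)).
    by have := divp_eq r V; move: (r %/ V) (r %% V) => q m ->; ring.
  by rewrite dvdp_addr ?dvdp_mulr.
move: rV => /dvdpP[W]; have [->|W0 eW] := eqVneq W 0.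
  rewrite mul0r => /eqP; rewrite subr_eq0 => /eqP eU; left.
  have r0 : tofrac r != 0 by rewrite tofrac_eq0; apply: contra_neq U0 => r0; rewrite eU r0 expr0n.
  by rewrite eU rmorphXn; apply: rep1_sqr.
(* The product of [V] and [- W] is a norm from the extension by the square root of [U], so the two
   define the same algebra with [U]. *)
have eN : V * (- W) = r ^+ 2 - U * 1 ^+ 2.
  by rewrite mulrN mulrC -eW; ring.
have NW0 : - W != 0 by rewrite oppr_eq0.
have eN' : tofrac V * tofrac (- W) = tofrac r ^+ 2 - tofrac U * 1 ^+ 2.
  by rewrite -rmorphM eN rmorphB rmorphXn rmorphM !expr1n rmorph1.
have repV w : rep (tofrac U) (tofrac V) w <-> rep (tofrac U) (tofrac (- W)) w.
  split; first by apply: rep_norm eN'; rewrite tofrac_eq0.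
  by rewrite mulrC in eN'; apply: rep_norm eN'; rewrite tofrac_eq0.
have [||/repV|[c [d [c0 d0 e]]]] := IH U (- W) _ U0 NW0.
- have s1 : (size (U - r ^+ 2)%R <= maxn (size U) (size (r ^+ 2)%R))%N.
    by rewrite -(size_polyN (r ^+ 2)); exact: size_polyD.
  have s2 : (size (r ^+ 2)%R <= (size r + size r).-1)%N.
    by rewrite expr2; exact: size_polyMleq.
  have s3 : size (- W) = size W by exact: size_polyN.
  have w0 : (0 < size W)%N by rewrite size_poly_gt0.
  have := size_mulF W0 V0; rewrite -eW s3; lia.
- apply: (unram_cancel NW0 h); apply: (unram_norm U0 _ eN).
  by rewrite mulf_neq0.
- by left.
by right; exists c, d; split=> // w; split=> [/repV/e//|/e/repV].
Qed.
End Unramified.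

(** * Fractions and common denominators *)

Lemma fraction_div (R : idomainType) (z : {fraction R}) :
  exists n d : R, d != 0 /\ z = tofrac n / tofrac d.
Proof.
elim/quotW: z => x; exists (\n_x)%R, (\d_x)%R.
have d0 := denom_ratioP x; split=> //.
apply/esym/(canLR (mulfK _)); rewrite ?tofrac_eq0 //.
rewrite -[_ * _]/(FracField.mul _ _) !piE /FracField.mulf.
apply/eqP; rewrite FracField.equivf_def /equivf ?numden_Ratio ?mulf_neq0 ?oner_eq0 //=.
by apply/eqP; ring.
Qed.

Lemma tofrac_inj (R : idomainType) : injective (@tofrac R).
Proof. by move=> x y /eqP; rewrite tofrac_eq => /eqP. Qed.

(* Stated over an abstract field because [field] does not terminate on a concrete
   fraction field. *)
Section Denominators.
Variable E : fieldType.

Lemma norm_clear_den (x y z t u v : E) : z != 0 -> t != 0 ->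
  v = (x / z) ^+ 2 - u * (y / t) ^+ 2 ->
  (z * t) ^+ 2 * v = (x * t) ^+ 2 - u * (y * z) ^+ 2.
Proof. by move=> z0 t0 ->; field; rewrite ?z0 ?t0. Qed.

Lemma form_clear_den (u v n d n' d' n'' d'' : E) :
  d != 0 -> d' != 0 -> d'' != 0 ->
  (u * (n / d) ^+ 2 + v * (n' / d') ^+ 2 - u * v * (n'' / d'') ^+ 2)
    * (d * d' * d'') ^+ 2
  = u * (n * d' * d'') ^+ 2 + v * (n' * d * d'') ^+ 2
    + - (u * v) * (n'' * d * d') ^+ 2.
Proof. by move=> d0 d0' d0''; field; rewrite ?d0 ?d0' ?d0''. Qed.

Lemma frac_square_den (n f g : E) : f != 0 -> g != 0 ->
  n / f = n * f * g ^+ 2 / (f * g) ^+ 2.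
Proof. by move=> f0 g0; field; rewrite ?f0 ?g0. Qed.

Lemma norm_scale (U T a b u t g : E) : g != 0 -> T = a ^+ 2 - U * b ^+ 2 ->
  U = u / g ^+ 2 -> T = t / g ^+ 2 -> t = (a * g) ^+ 2 - u * b ^+ 2.
Proof.
move=> g0 eT eU eT'; transitivity (T * g ^+ 2); first by rewrite eT'; field.
by rewrite eT eU; field.
Qed.

Lemma norm_scale_product (U T c d u t g : E) : g != 0 ->
  (T - 1) * (T - U) = c ^+ 2 - U * d ^+ 2 ->
  U = u / g ^+ 2 -> T = t / g ^+ 2 ->
  (t - u) * (t - g ^+ 2) = (c * g ^+ 2) ^+ 2 - u * (d * g) ^+ 2.
Proof.
move=> g0 e eU eT; transitivity ((T - 1) * (T - U) * g ^+ 4).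
  by rewrite eU eT; field.
by rewrite e eU; field.
Qed.
End Denominators.

(** * Specialising quaternion algebras at points of the line *)

Section Line.
Variable F : fieldType.
Hypothesis sqN1 : square (-1 : F).
Hypothesis two_neq0 : 2 != 0 :> F.
Implicit Types U V W T D p q : {poly F}.

Lemma unram_norm_frac U V (a b : {fraction {poly F}}) : U != 0 -> V != 0 ->
  tofrac V = a ^+ 2 - tofrac U * b ^+ 2 -> unram U V.
Proof.
have [n [d [d0 ->]]] := fraction_div a; have [m [e [e0 ->]]] := fraction_div b.
move=> U0 V0 eV; have de0 : d * e != 0 by rewrite mulf_neq0.
apply: (unram_cancel V0 (unram_sqr sqN1 U0 de0)).
apply: (@unram_norm _ sqN1 _ _ (n * e) (m * d)); rewrite ?mulf_neq0 ?expf_neq0 //.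
apply: tofrac_inj.
rewrite !(tofracB, tofracXn, tofracM).
by apply: norm_clear_den eV; rewrite tofrac_eq0.
Qed.

(** By homogeneity, a common zero of the coordinates at [al] can be divided out; each division
    lowers the size of [W], so the process ends with coordinates that do not all vanish at [al]. *)
Lemma spec_form (c0 c1 c2 c3 X Y Z W : {poly F}) al : W != 0 ->
  c0 * W ^+ 2 = c1 * X ^+ 2 + c2 * Y ^+ 2 + c3 * Z ^+ 2 ->
  exists w x y z : F, ~ [/\ w = 0, x = 0, y = 0 & z = 0] /\
  c0.[al] * w ^+ 2 = c1.[al] * x ^+ 2 + c2.[al] * y ^+ 2 + c3.[al] * z ^+ 2.
Proof.
elim: {W}(size W) {-2}W (leqnn (size W)) X Y Z => [|s IH] W sW X Y Z W0 e.
  by move: W0; rewrite -size_poly_eq0 -leqn0 sW.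
have [[w0 x0 y0 z0]|nz] := pselect [/\ W.[al] = 0, X.[al] = 0, Y.[al] = 0 & Z.[al] = 0]; last first.
  exists W.[al], X.[al], Y.[al], Z.[al]; split=> //.
  by have := congr1 (fun q => q.[al]) e; rewrite !hornerE.
have [W' eW] := factor_theorem _ _ (introT eqP w0).
have [X' eX] := factor_theorem _ _ (introT eqP x0).
have [Y' eY] := factor_theorem _ _ (introT eqP y0).
have [Z' eZ] := factor_theorem _ _ (introT eqP z0).
have W0' : W' != 0 by apply: contra_neq W0 => W0'; rewrite eW W0' mul0r.
apply: (IH W' _ X' Y' Z' W0').
  by move: sW; rewrite eW size_mulF ?polyXsubC_eq0 // size_XsubC; lia.
have xa0 : ('X - al%:P) ^+ 2 != 0 :> {poly F} by rewrite expf_neq0 ?polyXsubC_eq0.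
apply: (mulIf xa0); move: e; rewrite eW eX eY eZ => e.
have -> : c0 * W' ^+ 2 * ('X - al%:P) ^+ 2 = c0 * (W' * ('X - al%:P)) ^+ 2 by ring.
by rewrite e; ring.
Qed.

Lemma rep_spec U V W al : rep (tofrac U) (tofrac V) (tofrac W) ->
  exists w x y z : F, ~ [/\ w = 0, x = 0, y = 0 & z = 0] /\
  W.[al] * w ^+ 2 = U.[al] * x ^+ 2 + V.[al] * y ^+ 2 - U.[al] * V.[al] * z ^+ 2.
Proof.
move=> [x [y [z]]]; have [n [d [d0 ->]]] := fraction_div x.
have [n' [d' [d0' ->]]] := fraction_div y; have [n'' [d'' [d0'' ->]]] := fraction_div z.
move=> e; have D0 : d * d' * d'' != 0 by rewrite !mulf_neq0.
have [|w [x' [y' [z' [nz e']]]]] := @spec_form W U V (- (U * V)) (n * d' * d'') (n' * d * d'') (n'' * d * d') _ al D0.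
  apply: tofrac_inj.
  rewrite tofracM e !(tofracD, tofracN, tofracXn, tofracM).
  by apply: form_clear_den; rewrite ?tofrac_eq0.
exists w, x', y', z'; split=> //; rewrite e'; rewrite hornerN hornerM; ring.
Qed.

(** A nondegenerate isotropic form is universal. To the multiple by [l] of the isotropic vector one
    adds a basis vector not orthogonal to it; the value is then affine in [l], and [l] is solved
    for. *)
Lemma isotropic_rep1 (c d x y z : F) : c != 0 -> d != 0 ->
  ~ [/\ x = 0, y = 0 & z = 0] -> c * x ^+ 2 + d * y ^+ 2 - c * d * z ^+ 2 = 0 ->
  rep c d 1.
Proof.
move=> c0 d0 nz e.
have [x0|x0] := eqVneq x 0; last first.
  pose l := (1 - c) / (2 * c * x); exists (l * x + 1), (l * y), (l * z).
  transitivity (l ^+ 2 * (c * x ^+ 2 + d * y ^+ 2 - c * d * z ^+ 2) + (2 * l * c * x + c)); last ring.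
  by rewrite e /l; field; rewrite x0 c0.
have [y0|y0] := eqVneq y 0; last first.
  pose l := (1 - d) / (2 * d * y); exists (l * x), (l * y + 1), (l * z).
  transitivity (l ^+ 2 * (c * x ^+ 2 + d * y ^+ 2 - c * d * z ^+ 2) + (2 * l * d * y + d)); last ring.
  by rewrite e /l; field; rewrite y0 d0.
have z0 : z != 0 by apply/eqP => z0; apply: nz.
pose l := - (1 + c * d) / (2 * c * d * z); exists (l * x), (l * y), (l * z + 1).
transitivity (l ^+ 2 * (c * x ^+ 2 + d * y ^+ 2 - c * d * z ^+ 2) - (2 * l * c * d * z + c * d)); last ring.
by rewrite e /l; field; rewrite z0 c0 d0.
Qed.

(** Specialising at 0 leaves the constants [c] and [d] unchanged: their form over [F] either
    represents [e ^+ 2], hence 1 after scaling, or is isotropic. *)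
Lemma rep_square_const (c d e : F) U : c != 0 -> d != 0 -> e != 0 ->
  U.[0] = e ^+ 2 -> rep (tofrac c%:P) (tofrac d%:P) (tofrac U) ->
  rep (tofrac c%:P) (tofrac d%:P) 1.
Proof.
move=> c0 d0 e0 U0 /(rep_spec 0) [w [x [y [z [nz]]]]].
rewrite !hornerC U0 => E.
suff [x' [y' [z' E']]] : rep c d 1.
  by exists (tofrac x'%:P), (tofrac y'%:P), (tofrac z'%:P);
     rewrite -tofrac1 -polyC1 E' !(polyCD, polyCN, polyCM, tofracD, tofracN, tofracM).
have [w0|w0] := eqVneq w 0.
  apply: (isotropic_rep1 c0 d0 (x := x) (y := y) (z := z)) => [[x0 y0 z0]|]; first exact: nz.
  by rewrite -E w0 expr0n mulr0.
exists (x / (e * w)), (y / (e * w)), (z / (e * w)).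
transitivity ((c * x ^+ 2 + d * y ^+ 2 - c * d * z ^+ 2) / (e * w) ^+ 2).
  by rewrite -E; field; rewrite ?e0 ?w0.
by field; rewrite ?e0 ?w0.
Qed.

(** A quotient of two nonzero norms is a norm. A vanishing norm of a nonzero pair makes [u] a
    square. *)
Lemma isotropic_norm (u v w x y z : F) :
  ~ [/\ w = 0, x = 0, y = 0 & z = 0] ->
  w ^+ 2 - u * x ^+ 2 = v * (y ^+ 2 - u * z ^+ 2) ->
  square u \/ exists a b, v = a ^+ 2 - u * b ^+ 2.
Proof.
move=> nz e; have [n0|n0] := eqVneq (y ^+ 2 - u * z ^+ 2) 0; last first.
  right; pose n := y ^+ 2 - u * z ^+ 2.
  exists ((w * y - u * x * z) / n), ((x * y - w * z) / n).
  apply: (mulIf n0); rewrite -e /n; by field.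
have sq a b : b != 0 -> a ^+ 2 - u * b ^+ 2 = 0 -> square u.
  move=> b0 /eqP; rewrite subr_eq0 => /eqP ab; exists (a / b).
  by rewrite expr_div_n ab mulfK ?expf_neq0.
have y_0 a b : b = 0 -> a ^+ 2 - u * b ^+ 2 = 0 -> a = 0.
  by move=> -> /eqP; rewrite expr0n mulr0 subr0 sqrf_eq0 => /eqP.
have [z0|z0] := eqVneq z 0; last by left; apply: sq n0.
move: e; rewrite n0 mulr0 => e.
have [x0|x0] := eqVneq x 0; last by left; apply: sq e.
by case: nz; split=> //; [exact: y_0 e|exact: y_0 n0].
Qed.

(** [U] and [T] are the values of x1^2 and x4 along the line. The unramified algebra attached to [U]
    and [T - 1] splits: if it is constant, this is seen at 0, where [U] is a square. The splitting
    is then read at 1. *)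
Lemma norm_along_line (Nu Du Nt Dt : {poly F}) (a b c d : {fraction {poly F}})
    (e u t : F) :
  let U := tofrac Nu / tofrac Du in let T := tofrac Nt / tofrac Dt in
  T = a ^+ 2 - U * b ^+ 2 -> (T - 1) * (T - U) = c ^+ 2 - U * d ^+ 2 ->
  Du.[0] != 0 -> Dt.[0] != 0 -> Du.[1] != 0 -> Dt.[1] != 0 ->
  e != 0 -> Nu.[0] = e ^+ 2 * Du.[0] -> Nu.[1] = u * Du.[1] ->
  Nt.[1] = t * Dt.[1] -> u != 0 -> t != 0 -> t != 1 -> t != u ->
  square u \/ exists x y, t - 1 = x ^+ 2 - u * y ^+ 2.
Proof.
move=> U T eT eTU Du0 Dt0 Du1 Dt1 e0 Nu0 Nu1 Nt1 u0 t0 t1 tu.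
have nz1 (q : {poly F}) x : q.[x] != 0 -> q != 0 by apply: contra_neq => ->; rewrite horner0.
have Du_0 := nz1 _ _ Du0; have Dt_0 := nz1 _ _ Dt0.
(* [U1] and [T1] are [U] and [T] multiplied by the square of the common denominator [D], so that
   [T - 1] becomes [T1 - D ^+ 2] up to a square. *)
pose D := Du * Dt; pose U1 := Nu * Du * Dt ^+ 2; pose T1 := Nt * Dt * Du ^+ 2.
have D0 : D != 0 by rewrite mulf_neq0.
have dl0 : D.[1] != 0 by rewrite hornerM mulf_neq0.
have U11 : U1.[1] = u * D.[1] ^+ 2 by rewrite /U1 /D !(hornerM, horner_exp) Nu1; ring.
have T11 : T1.[1] = t * D.[1] ^+ 2 by rewrite /T1 /D !(hornerM, horner_exp) Nt1; ring.
have V11 : (T1 - D ^+ 2).[1] = (t - 1) * D.[1] ^+ 2.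
  by rewrite hornerD hornerN T11 horner_exp; ring.
have U10 : U1 != 0 by apply: (nz1 _ 1); rewrite U11 mulf_neq0 ?expf_neq0.
have T10 : T1 != 0 by apply: (nz1 _ 1); rewrite T11 mulf_neq0 ?expf_neq0.
have V10 : T1 - D ^+ 2 != 0.
  by apply: (nz1 _ 1); rewrite V11 mulf_neq0 ?expf_neq0 ?subr_eq0.
have TU0 : T1 - U1 != 0.
  by apply: (nz1 _ 1); rewrite hornerD hornerN T11 U11 -mulrBl mulf_neq0 ?expf_neq0 ?subr_eq0.
have UE : U = tofrac U1 / tofrac D ^+ 2.
  by rewrite /U /U1 /D !(tofracXn, tofracM); apply: frac_square_den; rewrite tofrac_eq0.
have TE : T = tofrac T1 / tofrac D ^+ 2.
  rewrite /T /T1 [D]mulrC !(tofracXn, tofracM); apply: frac_square_den; rewrite tofrac_eq0 //.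
have fD0 : tofrac D != 0 by rewrite tofrac_eq0.
have D_0 : D.[0] != 0 by rewrite hornerM mulf_neq0.
have U1_0 : U1.[0] = (e * D.[0]) ^+ 2.
  by rewrite /U1 /D !(hornerM, horner_exp) Nu0; ring.
clearbody U T D U1 T1.
have h1 : unram U1 T1.
  apply: (@unram_norm_frac _ _ (a * tofrac D) b) => //.
  by apply: norm_scale eT _ _ => //.
have h2 : unram U1 ((T1 - U1) * (T1 - D ^+ 2)).
  apply: (@unram_norm_frac _ _ (c * tofrac D ^+ 2) (d * tofrac D) U10 (mulf_neq0 TU0 V10)).
  rewrite !(tofracB, tofracXn, tofracM).
  by apply: norm_scale_product eTU _ _ => //.
have h := unram_difference sqN1 U10 T10 D0 V10 TU0 h1 h2.
(* Representing 1 means splitting. Specialisation at 1 turns this into an isotropic norm equation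
   once the nonzero factor [D.[1]] is absorbed into the coordinates. *)
suff : rep (tofrac U1) (tofrac (T1 - D ^+ 2)) (tofrac 1).
  move=> /(rep_spec 1) [w [x [y [z [nz]]]]]; rewrite U11 V11 hornerC mul1r => E.
  apply: (@isotropic_norm _ _ w (D.[1] * x) (D.[1] * y) (D.[1] ^+ 2 * z)); last by rewrite E; ring.
  move=> [w0 /eqP x0 /eqP y0 /eqP z0]; apply: nz; split=> //; apply/eqP.
  - by move: x0; rewrite mulf_eq0 (negPf dl0).
  - by move: y0; rewrite mulf_eq0 (negPf dl0).
  - by move: z0; rewrite mulf_eq0 expf_eq0 (negPf dl0).
(* In the constant case the algebra still represents its own entry [U1], whose value at 0 is a
   nonzero square. *)
rewrite tofrac1; have [//|[c' [d' [c0 d0 E]]]] := unram_constant sqN1 U10 V10 h.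
apply/E; apply: (@rep_square_const c' d' (e * D.[0]) U1) => //.
  by rewrite mulf_neq0.
by apply/E; exists 1, 0, 0; ring.
Qed.
End Line.

(** * Points of retract rational extensions *)

(** The value at [z] is [h a / h b] for any presentation [z * i b = i a] with [h b] nonzero; the
    condition on kernels makes it independent of the presentation. This covers localisations as well
    as fraction fields. *)
Lemma extend_to_fractions (R M : comNzRingType) (E : fieldType)
    (i : {rmorphism R -> M}) (h : {rmorphism R -> E}) :
  (forall a, i a = 0 -> h a = 0) ->
  (forall z, exists a b, z * i b = i a /\ h b != 0) ->
  exists G : {rmorphism M -> E}, forall a, G (i a) = h a.
Proof.
move=> ih /choice[N /choice[D ND]].
pose G z := h (N z) / h (D z).
have GE z a b : z * i b = i a -> h b != 0 -> G z = h a / h b.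
  move=> e b0; have [e' d0] := ND z; apply/eqP; rewrite /G eqr_div // -!rmorphM.
  rewrite -subr_eq0 -rmorphB; apply/eqP/ih.
  by rewrite rmorphB !rmorphM -e -e'; ring.
have G_zmod : zmod_morphism G.
  move=> z w; have [ez dz] := ND z; have [ew dw] := ND w.
  rewrite (GE _ (N z * D w - N w * D z) (D z * D w)).
  - by rewrite rmorphB !rmorphM /G; field; rewrite ?dz ?dw.
  - by rewrite rmorphB !rmorphM -ez -ew; ring.
  - by rewrite rmorphM mulf_neq0.
have G_monoid : monoid_morphism G.
  split=> [|z w]; first by rewrite (GE _ 1 1) ?rmorph1 ?divr1 ?oner_eq0 ?mulr1.
  have [ez dz] := ND z; have [ew dw] := ND w.
  rewrite (GE _ (N z * N w) (D z * D w)).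
  - by rewrite !rmorphM /G; field; rewrite ?dz ?dw.
  - by rewrite !rmorphM -ez -ew; ring.
  - by rewrite rmorphM mulf_neq0.
pose mz := GRing.isZmodMorphism.Build _ _ G G_zmod.
pose mm := GRing.isMonoidMorphism.Build _ _ G G_monoid.
exists (HB.pack_for {rmorphism M -> E} G mz mm) => a /=.
by rewrite (GE _ a 1) ?rmorph1 ?divr1 ?oner_eq0 ?mulr1.
Qed.

Lemma mpoly_rmorph_ext (k : fieldType) (n : nat) (S : comNzRingType)
    (g g' : {rmorphism {mpoly k[n]} -> S}) :
  (forall c : k, g c%:MP = g' c%:MP) -> (forall i, g 'X_i = g' 'X_i) ->
  g =1 g'.
Proof.
move=> gC gX; elim/mpolyind => [|c mm p _ _ IH]; first by rewrite !rmorph0.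
rewrite !rmorphD IH -mul_mpolyC !rmorphM gC; congr (_ * _ + _).
by rewrite mpolyXE_id !rmorph_prod; apply: eq_bigr => i _; rewrite !rmorphXn gX.
Qed.

Section Retract.
Variables (k L F : fieldType) (iota : {rmorphism k -> L}).
Variables (j h : {rmorphism L -> F}).
Hypothesis jh : forall c, j (iota c) = h (iota c).

Section Localization.
Variables (m : nat) (f : {mpoly k[m]}).

Lemma mloc_poly : exists im : {rmorphism {mpoly k[m]} -> mloc f},
  forall p, val (im p) = tofrac p.
Proof.
have im_mloc p : tofrac p \in mloc_pred f.
  by apply/asboolP; exists p, 0%N; rewrite expr0 divr1.
pose im p : mloc f := SubringOf (im_mloc p).
have im_zmod : zmod_morphism im by move=> p q; apply: val_inj; rewrite /= rmorphB.
have im_monoid : monoid_morphism im.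
  by split=> [|p q]; apply: val_inj; rewrite /= ?rmorph1 ?rmorphM.
pose mz := GRing.isZmodMorphism.Build _ _ im im_zmod.
pose mm := GRing.isMonoidMorphism.Build _ _ im im_monoid.
by exists (HB.pack_for {rmorphism {mpoly k[m]} -> mloc f} im mz mm).
Qed.

Hypothesis f0 : f != 0.

Lemma mloc_inv (im : {rmorphism {mpoly k[m]} -> mloc f}) :
  (forall p, val (im p) = tofrac p) -> exists y, im f * y = 1.
Proof.
move=> imE; have fV : (tofrac f)^-1 \in mloc_pred f.
  by apply/asboolP; exists 1, 1%N; rewrite rmorph1 expr1 div1r.
exists (SubringOf fV : mloc f); apply: val_inj.
by rewrite rmorphM rmorph1 /= imE divff ?tofrac_eq0.
Qed.

Lemma mloc_fraction (im : {rmorphism {mpoly k[m]} -> mloc f}) :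
  (forall p, val (im p) = tofrac p) ->
  forall z : mloc f, exists p n, z * im f ^+ n = im p.
Proof.
move=> imE z; have /asboolP[p [n e]] := valP z; exists p, n; apply: val_inj.
by rewrite rmorphM rmorphXn /= !imE e mulfVK // expf_neq0 ?tofrac_eq0.
Qed.
End Localization.

(* The line joins the images in affine space of the two F-points j and h. *)
Lemma retract_line : retract_rational iota ->
  exists G : {rmorphism L -> {fraction {poly F}}}, forall z,
  exists N D : {poly F}, [/\ D.[0] != 0, D.[1] != 0, G z = tofrac N / tofrac D,
    N.[0] = h z * D.[0] & N.[1] = j z * D.[1]].
Proof.
move=> [A [_ frac [m [f [phi [psi [f0 _ psiC phiK]]]]]]].
have [im imE] := mloc_poly f; have [fi fiE] := mloc_inv f0 imE.
have fracM := mloc_fraction f0 imE.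
pose P i := j (val (psi (im 'X_i))); pose Q i := h (val (psi (im 'X_i))).
(* Restriction to the line through [Q], at parameter 0, and [P], at parameter 1. *)
pose g : {rmorphism {mpoly k[m]} -> {poly F}} :=
  mmap (polyC \o h \o iota) (fun i => (Q i)%:P + 'X * (P i - Q i)%:P).
have gC c : g c%:MP = (h (iota c))%:P by rewrite /g /= mmapC.
have gX i : g 'X_i = (Q i)%:P + 'X * (P i - Q i)%:P by rewrite /g /= mmapX mmap1U.
clearbody g.
have psiC' c : val (psi (im c%:MP)) = iota c by apply: psiC; rewrite imE.
have g0 p : (g p).[0] = h (val (psi (im p))).
  pose e0 : {rmorphism {mpoly k[m]} -> F} := horner_eval 0 \o g.
  pose e1 : {rmorphism {mpoly k[m]} -> F} := h \o val \o psi \o im.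
  apply: (@mpoly_rmorph_ext _ _ _ e0 e1) => [c|i]; rewrite /= /horner_eval.
    by rewrite gC hornerC psiC'.
  by rewrite gX hornerD hornerM !hornerC hornerX mul0r addr0.
have g1 p : (g p).[1] = j (val (psi (im p))).
  pose e0 : {rmorphism {mpoly k[m]} -> F} := horner_eval 1 \o g.
  pose e1 : {rmorphism {mpoly k[m]} -> F} := j \o val \o psi \o im.
  apply: (@mpoly_rmorph_ext _ _ _ e0 e1) => [c|i]; rewrite /= /horner_eval.
    by rewrite gC hornerC psiC' jh.
  by rewrite gX hornerD hornerM !hornerC hornerX mul1r addrC subrK.
have [vA vAE] : exists vA : {rmorphism subring_of A -> L},
    forall a, vA a = val a by exists val.
(* As [f] is a unit of the localisation, its image under [psi] is nonzero, so [f] vanishes at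
   neither end of the line. *)
have psif0 : val (psi (im f)) != 0.
  have fe : psi (im f) * psi fi = 1 by rewrite -rmorphM fiE rmorph1.
  apply/eqP => e; have := congr1 vA fe.
  by rewrite rmorphM vAE e mul0r rmorph1 => /esym/eqP; rewrite oner_eq0.
have gf0 : (g f).[0] != 0 by rewrite g0 fmorph_eq0.
have gf1 : (g f).[1] != 0 by rewrite g1 fmorph_eq0.
have gf : g f != 0 by apply: contra_neq gf0 => ->; rewrite horner0.
have [ev evE] : exists ev : {rmorphism mloc f -> {fraction {poly F}}},
    forall p, ev (im p) = tofrac (g p).
  apply: (@extend_to_fractions _ _ _ im (@tofrac {poly F} \o g)) => [a a0|z].
    suff -> : a = 0 by rewrite rmorph0.
    by apply/eqP; rewrite -tofrac_eq0 -imE a0 rmorph0.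
  have [p [n e]] := fracM z; exists p, (f ^+ n); rewrite rmorphXn; split=> //.
  by rewrite /= tofrac_eq0 rmorphXn expf_neq0.
have evA a : exists N D : {poly F}, [/\ D.[0] != 0, D.[1] != 0,
    ev (phi a) = tofrac N / tofrac D,
    N.[0] = h (val a) * D.[0] & N.[1] = j (val a) * D.[1]].
  have [p [n e]] := fracM (phi a); exists (g p), (g f ^+ n).
  have e' : val (psi (im p)) = val a * val (psi (im f)) ^+ n.
    by rewrite -!vAE -e !rmorphM !rmorphXn phiK.
  rewrite !horner_exp !expf_neq0 //; split=> //.
  - apply: (canRL (mulfK _)); first by rewrite tofrac_eq0 expf_neq0.
    by rewrite -evE -e tofracXn !rmorphM rmorphXn evE.
  - by rewrite g0 e' rmorphM rmorphXn g0.
  - by rewrite g1 e' rmorphM rmorphXn g1.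
have [G GE] : exists G : {rmorphism L -> {fraction {poly F}}},
    forall a : subring_of A, G (vA a) = ev (phi a).
  apply: (@extend_to_fractions _ _ _ vA (ev \o phi)) => [a a0|z].
    suff -> : a = 0 by rewrite !rmorph0.
    by apply: val_inj; rewrite -!vAE a0 rmorph0.
  have [a [b [aA bA b0 ez]]] := frac z.
  exists (SubringOf aA), (SubringOf bA); rewrite !vAE /= ez mulfVK //; split=> //.
  (* The image of [b] is nonzero because its numerator takes the nonzero value [h b * D.[0]] at
     0. *)
  have [N [D [D0 D1 -> N0 N1]]] := evA (SubringOf bA).
  rewrite mulf_neq0 ?invr_eq0 // tofrac_eq0.
    by apply: contraTneq b0 => N_0; move: N0; rewrite N_0 horner0 => /esym/eqP; rewrite mulf_eq0 (negPf D0) orbF fmorph_eq0 => ->.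
  by apply: contra_neq D0 => ->; rewrite horner0.
exists G => z; have [a [b [aA bA b0 ez]]] := frac z.
have [N [D [D0 D1 e N0 N1]]] := evA (SubringOf aA).
have [N' [D' [D0' D1' e' N0' N1']]] := evA (SubringOf bA).
rewrite -GE vAE /= in e; rewrite -GE vAE /= in e'; rewrite /= in N0 N1 N0' N1'.
exists (N * D'), (D * N').
have hb : h b != 0 by rewrite fmorph_eq0.
have jb : j b != 0 by rewrite fmorph_eq0.
split.
- by rewrite hornerM N0' !mulf_neq0.
- by rewrite hornerM N1' !mulf_neq0.
- by rewrite ez fmorph_div /= e e' !tofracM invf_div mulf_div.
- by rewrite !hornerM ez fmorph_div /= N0 N0'; field.
- by rewrite !hornerM ez fmorph_div /= N1 N1'; field.
Qed.
End Retract.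

(** * Twisted involutions of rational function fields *)

Lemma poly_rmorph_ext (R S : nzRingType) (g g' : {rmorphism {poly R} -> S}) :
  (forall c, g c%:P = g' c%:P) -> g 'X = g' 'X -> g =1 g'.
Proof.
move=> gC gX; elim/poly_ind => [|p c IH]; first by rewrite !rmorph0.
by rewrite !rmorphD !rmorphM IH gC gX.
Qed.

Lemma fraction_rmorph_ext (R : idomainType) (E : fieldType)
    (g g' : {rmorphism {fraction R} -> E}) :
  (forall r, g (tofrac r) = g' (tofrac r)) -> g =1 g'.
Proof.
by move=> e z; have [n [d [_ ->]]] := fraction_div z; rewrite !fmorph_div !e.
Qed.

Lemma extend_fraction (R : idomainType) (E : fieldType) (h : {rmorphism R -> E}) :
  injective h ->
  exists G : {rmorphism {fraction R} -> E}, forall a, G (tofrac a) = h a.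
Proof.
move=> hI; apply: (@extend_to_fractions R {fraction R} E (@tofrac R) h) => [a a0|z].
  suff -> : a = 0 by rewrite rmorph0.
  by apply: tofrac_inj; rewrite tofrac0.
have [n [d [d0 ->]]] := fraction_div z; exists n, d; split.
  by rewrite mulfVK ?tofrac_eq0.
by rewrite -(rmorph0 h) (inj_eq hI).
Qed.

Section RationalFunctions.
Variable M : fieldType.

Notation Mx := {fraction {poly M}}.

Definition cst (c : M) : Mx := tofrac c%:P.
HB.instance Definition _ :=
  GRing.RMorphism.copy cst (@tofrac {poly M} \o @polyC M).

Definition varX : Mx := tofrac 'X.

Lemma varX_neq0 : varX != 0.
Proof. by rewrite tofrac_eq0 polyX_eq0. Qed.

Lemma ratfun_rmorph_ext (E : fieldType) (g g' : {rmorphism Mx -> E}) :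
  (forall c, g (cst c) = g' (cst c)) -> g varX = g' varX -> g =1 g'.
Proof.
move=> gC gX; apply: fraction_rmorph_ext => r.
exact: (@poly_rmorph_ext _ _ (g \o @tofrac _) (g' \o @tofrac _)).
Qed.

Variable sg : {rmorphism M -> M}.

(** The hypothesis says that [y] is transcendental over [M]; so applying [sg] to the coefficients
    and evaluating at [y] is injective on polynomials and extends to fractions. *)
Lemma extend_semilinear (y : Mx) :
  (forall P : {poly M}, P != 0 -> (map_poly cst P).[y] != 0) ->
  exists tau : {rmorphism Mx -> Mx},
    (forall c, tau (cst c) = cst (sg c)) /\ tau varX = y.
Proof.
move=> ytr.
pose h : {rmorphism {poly M} -> Mx} := horner_eval y \o map_poly cst \o map_poly sg.
have hE P : h P = (map_poly cst (map_poly sg P)).[y] by [].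
have [P Q /eqP|tau tauE] := @extend_fraction _ _ h.
  rewrite -subr_eq0 -rmorphB hE => e; apply/eqP; rewrite -subr_eq0.
  by apply: contraTT e => e; apply: ytr; rewrite map_poly_eq0.
exists tau; split=> [c|].
  by rewrite /cst tauE hE !map_polyC hornerC.
by rewrite tauE hE !map_polyX hornerX.
Qed.

Lemma extend_scale (e : M) : e != 0 ->
  exists tau : {rmorphism Mx -> Mx},
    (forall c, tau (cst c) = cst (sg c)) /\ tau varX = cst e * varX.
Proof.
move=> e0; apply: extend_semilinear => P P0.
suff -> : (map_poly cst P).[cst e * varX] = tofrac (P \Po (e *: 'X)).
  by rewrite tofrac_eq0 -size_poly_eq0 size_comp_poly2 ?size_poly_eq0 // size_scale ?size_polyX.
pose ev : {rmorphism {poly M} -> Mx} := horner_eval (cst e * varX) \o map_poly cst.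
pose cp : {rmorphism {poly M} -> Mx} := @tofrac _ \o comp_poly (e *: 'X).
apply: (@poly_rmorph_ext _ _ ev cp) => [c|] /=; rewrite /horner_eval.
  by rewrite map_polyC hornerC comp_polyC.
by rewrite map_polyX hornerX comp_polyX -mul_polyC tofracM.
Qed.

Section Inversion.
Variable N : M.
Hypothesis N0 : N != 0.

(** [P'] is the reciprocal polynomial twisted by powers of [N]: its coefficients are those of [P] in
    reverse order, and its constant one comes from the leading one of [P]. *)
Lemma reverse_poly (P : {poly M}) : P != 0 -> exists P' : {poly M},
  [/\ (size P' <= size P)%N, P'`_0 != 0, P'`_(size P).-1 = P`_0
    & tofrac P' = varX ^+ (size P).-1 * (map_poly cst P).[cst N / varX]].
Proof.
move=> P0; set d := (size P).-1.
have sP : size P = d.+1 by rewrite prednK // size_poly_gt0.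
exists (\poly_(i < d.+1) (P`_(d - i) * N ^+ (d - i))); split.
- by rewrite sP size_poly.
- by rewrite coef_poly /= subn0 mulf_neq0 ?expf_neq0 // -lead_coefE lead_coef_eq0.
- by rewrite coef_poly ltnSn subnn mulr1.
rewrite horner_coef size_map_poly sP poly_def rmorph_sum mulr_sumr /=.
rewrite (reindex_inj rev_ord_inj) /=; apply: eq_bigr => i _.
have id : (i <= d)%N by rewrite -ltnS.
rewrite subSS subKn // -mul_polyC tofracM tofracXn coef_map /=.
have -> : varX ^+ d = varX ^+ (d - i) * varX ^+ i by rewrite -exprD subnK.
rewrite expr_div_n -/(cst _) -/varX rmorphM rmorphXn.
have E4 (E : fieldType) (a b x y : E) : y != 0 -> a * b * x = x * y * (a * (b / y)).
  by move=> y0; field.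
by apply: E4; rewrite expf_neq0 ?varX_neq0.
Qed.

Lemma extend_inversion : exists tau : {rmorphism Mx -> Mx},
  (forall c, tau (cst c) = cst (sg c)) /\ tau varX = cst N / varX.
Proof.
apply: extend_semilinear => P P0; have [P' [_ c0 _ e]] := reverse_poly P0.
have : tofrac P' != 0 by rewrite tofrac_eq0; apply: contra_neq c0 => ->; rewrite coef0.
by rewrite e mulf_eq0 negb_or => /andP[].
Qed.
End Inversion.
End RationalFunctions.

(** * Norm equations over a rational function field *)

Lemma coprime_fraction (M : fieldType) (z : {fraction {poly M}}) : z != 0 ->
  exists (P Q : {poly M}) i l, [/\ P`_0 != 0, Q`_0 != 0, coprimep P Q
    & z = varX M ^+ i * tofrac P / (varX M ^+ l * tofrac Q)].
Proof.
move=> z0; have [n [d [d0 ez]]] := fraction_div z.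
have n0 : n != 0 by apply: contra_neq z0 => n0; rewrite ez n0 tofrac0 mul0r.
have cop : coprimep (n %/ gcdp n d) (d %/ gcdp n d) by rewrite coprimep_div_gcd ?n0.
have g0 : gcdp n d != 0 by rewrite gcdp_eq0 negb_and n0.
have en := divpK (dvdp_gcdl n d); have ed := divpK (dvdp_gcdr n d).
move: en ed cop g0; move: (n %/ _) (d %/ _) => n' d'.
move: (gcdp n d) => g en ed cop g0.
have n0' : n' != 0 by apply: contra_neq n0 => e; rewrite -en e mul0r.
have d0' : d' != 0 by apply: contra_neq d0 => e; rewrite -ed e mul0r.
have X1 : (1 < size ('X : {poly M}))%N by rewrite size_polyX.
have coef0X (p : {poly M}) : ~~ ('X %| p) -> p`_0 != 0.
  by rewrite -['X]subr0 -polyC0 dvdp_XsubCl rootE horner_coef0.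
have [i [P [eP XP]]] := poly_ord X1 n0'; have [l [Q [eQ XQ]]] := poly_ord X1 d0'.
exists P, Q, i, l; split; [exact: coef0X|exact: coef0X| |].
  apply: (@coprimep_dvdl _ d'); first by rewrite eQ dvdp_mull.
  by apply: coprimep_dvdr cop; rewrite eP dvdp_mull.
rewrite ez -en -ed !tofracM -mulf_div divff ?tofrac_eq0 // mulr1 eP eQ.
by rewrite !tofracM !tofracXn.
Qed.

Section NormDescent.
Variables (M : fieldType) (sg : {rmorphism M -> M}) (N : M).
Notation Mx := {fraction {poly M}}.
Notation X := (varX M).
Variable tau : {rmorphism Mx -> Mx}.
Hypotheses (N0 : N != 0) (tauC : forall c, tau (cst c) = cst (sg c)).
Hypotheses (tauX : tau X = cst N / X) (tauK : involutive tau).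

(** A nonzero constant coefficient of [P] becomes the top coefficient of [P'], so the degree is
    preserved. *)
Lemma tau_poly (P : {poly M}) : P`_0 != 0 -> exists P' : {poly M},
  [/\ P'`_0 != 0, size P' = size P & tofrac P' = X ^+ (size P).-1 * tau (tofrac P)].
Proof.
move=> P0; pose Q := map_poly sg P.
have sQ : size Q = size P by rewrite size_map_poly.
have Q0 : Q != 0 by rewrite map_poly_eq0; apply: contra_neq P0 => ->; rewrite coef0.
have [P' [sP' c0 cd e]] := reverse_poly N0 Q0; rewrite sQ in sP' cd e.
exists P'; split=> //.
  apply/eqP; rewrite eqn_leq sP' /=.
  have : P'`_(size P).-1 != 0 by rewrite cd coef_map fmorph_eq0.
  apply: contraNT; rewrite -ltnNge => lt; rewrite nth_default //.
  by move: lt; case: (size P).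
rewrite e; congr (_ * _).
pose g : {rmorphism {poly M} -> Mx} := tau \o @tofrac _.
pose ev : {rmorphism {poly M} -> Mx} := horner_eval (cst N / X) \o map_poly (@cst M) \o map_poly sg.
rewrite -[LHS]/(ev P) -[RHS]/(g P).
apply: (@poly_rmorph_ext _ _ ev g) => [c|] /=; rewrite /horner_eval.
  by rewrite !map_polyC hornerC /= -tauC.
by rewrite !map_polyX hornerX -tauX.
Qed.

(** This eliminates the variable: clearing denominators in the norm equation and comparing coprime
    factors leaves a norm equation over [M], at the cost of powers of [N]. *)
Lemma norm_descent (a : M) (z : Mx) : a != 0 -> cst a = z * tau z ->
  exists c m n, c != 0 /\ a * N ^+ m * (c * sg c) = N ^+ n.
Proof.
move=> a0 ea; have z0 : z != 0.
  by apply: contra_neq a0 => z0; apply/eqP; move/eqP: ea; rewrite z0 mul0r fmorph_eq0.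
have [P [Q [i [l [P0 Q0 cop ez]]]]] := coprime_fraction z0.
have [P' [P0' sP' eP']] := tau_poly P0; have [Q' [Q0' sQ' eQ']] := tau_poly Q0.
have nz (p : {poly M}) : p`_0 != 0 -> p != 0 by apply: contra_neq => ->; rewrite coef0.
have Pn := nz _ P0; have Qn := nz _ Q0; have Pn' := nz _ P0'; have Qn' := nz _ Q0'.
set d := (size P).-1 in eP'; set e := (size Q).-1 in eQ'.
have E1 : (N ^+ i)%:P * P * P' * 'X^e = (a * N ^+ l)%:P * Q * Q' * 'X^d.
  apply: tofrac_inj; rewrite !tofracM eP' eQ' !tofracXn -!/(cst _) -/X.
  rewrite rmorphM !rmorphXn.
  move: ea; rewrite ez fmorph_div !rmorphM !rmorphXn tauX !expr_div_n.
  have id (E : fieldType) (ni nl xi xl p q tp tq A xd xe : E) :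
      ni != 0 -> nl != 0 -> xi != 0 -> xl != 0 -> q != 0 -> tq != 0 ->
      A = xi * p / (xl * q) * (ni / xi * tp / (nl / xl * tq)) ->
      ni * p * (xd * tp) * xe = A * nl * q * (xe * tq) * xd.
    move=> h1 h2 h3 h4 h5 h6 ->; field.
    by rewrite ?h1 ?h2 ?h3 ?h4 ?h5 ?h6.
  by apply: id; rewrite ?expf_neq0 ?varX_neq0 ?fmorph_eq0 ?tofrac_eq0.
have sE (c : M) (A B : {poly M}) n : c != 0 -> A != 0 -> B != 0 ->
    size (c%:P * A * B * 'X^n) = (n + (size A + size B).-1)%N.
  move=> c0 A0 B0; rewrite -!mulrA mul_polyC.
  by rewrite size_scale // mulrA size_mulXn ?mulf_neq0 // size_mulF.
have Ps : (0 < size P)%N by rewrite size_poly_gt0.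
have Qs : (0 < size Q)%N by rewrite size_poly_gt0.
(* Degrees give [e + 2 * d = d + 2 * e], so the powers of ['X] in [E1] cancel. *)
have de : d = e.
  have := congr1 (fun p : {poly M} => size p) E1.
  rewrite !sE ?mulf_neq0 ?expf_neq0 // sP' sQ' /d /e.
  by move: Ps Qs; move: (size P) (size Q) => s t; clear; lia.
rewrite -de in E1 eQ'; have {}E1 := mulIf (expf_neq0 d (negbT (polyX_eq0 M))) E1.
have sPQ : size P = size Q'.
  by rewrite sQ'; move: de Ps Qs; rewrite /d /e; case: (size P) (size Q) => [|s] [|t] //= ->.
(* [P] is coprime to [Q], hence divides [Q'], and both have the same size. *)
have [c c0 eQ] : exists2 c, c != 0 & Q' = c *: P.
  have dv : P %| Q'.
    rewrite -(Gauss_dvdpr Q' cop).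
    have : P %| (a * N ^+ l)%:P * Q * Q' by rewrite -E1 -mulrA mulrCA dvdp_mulr.
    rewrite -mulrA mul_polyC dvdpZr // mulf_neq0 ?expf_neq0 //.
  have : P %= Q' by rewrite -dvdp_size_eqp // sPQ.
  move=> /eqp_eq E; exists (lead_coef Q' / lead_coef P).
    by rewrite mulf_neq0 ?invr_eq0 ?lead_coef_eq0.
  by rewrite mulrC -scalerA E scalerA mulVf ?scale1r // lead_coef_eq0.
(* This is [tau] applied to [Q' = c *: P]; combined with [E3] it cancels [P'] and [Q]. *)
have E2 : cst N ^+ d * tofrac Q = cst (sg c) * tofrac P'.
  have -> : tofrac Q = tau (tofrac Q' / X ^+ d).
    by rewrite eQ' mulrAC divff ?expf_neq0 ?varX_neq0 // mul1r tauK.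
  rewrite fmorph_div rmorphXn tauX eQ -mul_polyC tofracM rmorphM -/(cst c) tauC eP'.
  rewrite expr_div_n.
  have id (E : fieldType) (nd xd s tp : E) : nd != 0 -> xd != 0 ->
      nd * (s * tp / (nd / xd)) = s * (xd * tp).
    by move=> h1 h2; field; rewrite ?h1 ?h2.
  by apply: id; rewrite expf_neq0 ?varX_neq0 ?fmorph_eq0.
have E3 : cst (N ^+ i) * tofrac P' = cst (a * N ^+ l * c) * tofrac Q.
  have : (N ^+ i)%:P * P' = (a * N ^+ l * c)%:P * Q.
    apply: (mulfI Pn); rewrite mulrCA mulrA E1 eQ -mul_polyC polyCM; ring.
  by move=> /(congr1 (@tofrac _)); rewrite !tofracM.
exists c, l, (i + d)%N; split=> //.
have cstI : injective (@cst M) by exact: fmorph_inj.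
apply: cstI; rewrite exprD.
have Pf : tofrac P' != 0 by rewrite tofrac_eq0.
apply: (mulIf Pf).
have -> : cst (N ^+ i * N ^+ d) * tofrac P' = cst (a * N ^+ l * c) * (cst (sg c) * tofrac P').
  transitivity (cst (N ^+ d) * (cst (N ^+ i) * tofrac P')).
    by rewrite [cst (N ^+ i * _)]rmorphM mulrA [cst (N ^+ d) * _]mulrC.
  by rewrite E3 mulrCA [cst (N ^+ d)]rmorphXn E2.
by rewrite !mulrA -[cst (_ * c) * _]rmorphM -!mulrA.
Qed.
End NormDescent.

Section Parity.
Variables (M : fieldType) (sg : {rmorphism M -> M}).
Notation Mx := {fraction {poly M}}.
Notation X := (varX M).
Variable tau : {rmorphism Mx -> Mx}.
Hypotheses (tauC : forall c, tau (cst c) = cst (sg c)) (tauX : tau X = X).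
Variable u : M.
Hypotheses (u0 : u != 0) (u1 : u != 1) (sgu : sg u = u).

Lemma mup_conj (P : {poly M}) x : P != 0 -> sg x = x ->
  mup x (map_poly sg P) = mup x P.
Proof.
move=> P0 sx; have Q0 : map_poly sg P != 0 by rewrite map_poly_eq0.
apply/eqP; rewrite eqn_leq; apply/andP.
have e n : ('X - x%:P) ^+ n = map_poly sg (('X - x%:P) ^+ n).
  by rewrite rmorphXn rmorphB /= map_polyX map_polyC /= sx.
split; last by rewrite mup_geq // e dvdp_map -mup_geq.
by rewrite mup_geq // -(dvdp_map sg) -e -mup_geq.
Qed.

(** [P] and its conjugate vanish to the same order at a point fixed by [sg], so norms have even
    multiplicity at 1 and at [u]. Modulo 2 an equality would give [1 + m = n] at 1 and [m = n] at
    [u]; the powers of [X] do not vanish there. *)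
Lemma norm_parity (c : Mx) m m' n n' :
  (X - 1) * ((X - 1) * (X - cst u)) ^+ m * X ^+ m' * (c * tau c) !=
  ((X - 1) * (X - cst u)) ^+ n * X ^+ n'.
Proof.
apply/negP => /eqP E; have [P [Q [Q0 ec]]] := fraction_div c.
have tauP (p : {poly M}) : tau (tofrac p) = tofrac (map_poly sg p).
  pose g : {rmorphism {poly M} -> Mx} := tau \o @tofrac _.
  pose ev : {rmorphism {poly M} -> Mx} := @tofrac _ \o map_poly sg.
  rewrite -[LHS]/(g p) -[RHS]/(ev p).
  apply: (@poly_rmorph_ext _ _ g ev) => [a|] /=.
    by rewrite -/(cst a) tauC map_polyC.
  by rewrite map_polyX -/X tauX.
have X1 : X - 1 = tofrac ('X - 1%:P) by rewrite tofracB tofrac1.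
have Xu : X - cst u = tofrac ('X - u%:P) by rewrite tofracB.
have X0 : X = tofrac ('X - 0%:P) by rewrite subr0.
have XaP (a : M) : 'X - a%:P != 0 := negbT (polyXsubC_eq0 a).
have P0 : P != 0.
  apply/eqP => P0; move/eqP: E; rewrite ec P0 tofrac0 !mul0r mulr0 eq_sym.
  by rewrite X1 Xu mulf_eq0 !expf_eq0 mulf_eq0 !tofrac_eq0 !(negPf (XaP _)) polyX_eq0 !andbF.
have E' : ('X - 1%:P) * (('X - 1%:P) * ('X - u%:P)) ^+ m * ('X - 0%:P) ^+ m' * (P * map_poly sg P)
    = (('X - 1%:P) * ('X - u%:P)) ^+ n * ('X - 0%:P) ^+ n' * (Q * map_poly sg Q).
  have id (E0 : fieldType) (l r p q p' q' : E0) : q != 0 -> q' != 0 ->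
      l * (p / q * (p' / q')) = r -> l * (p * p') = r * (q * q').
    by move=> h h' <-; field; rewrite ?h ?h'.
  apply: tofrac_inj; rewrite [LHS]tofracM [RHS]tofracM [tofrac (P * _)]tofracM.
  rewrite [tofrac (Q * _)]tofracM; apply: id.
  - by rewrite tofrac_eq0.
  - by rewrite tofrac_eq0 map_poly_eq0.
  rewrite -!tauP -fmorph_div -ec !(tofracXn, tofracM) -X1 -Xu -X0; exact: E.
have mupE x : sg x = x -> mup x (('X - 1%:P) * (('X - 1%:P) * ('X - u%:P)) ^+ m * ('X - 0%:P) ^+ m' * (P * map_poly sg P))
   = ((1%R == x) + ((if 1%R == x then m else 0) + (if u == x then m else 0)) + (if 0%R == x then m' else 0)
     + (mup x P).*2)%N.
  move=> sx; rewrite !mupM ?mulf_neq0 ?expf_neq0 ?mulf_neq0 ?XaP ?map_poly_eq0 //.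
  rewrite exprMn mupM ?expf_neq0 ?XaP // !mup_XsubCX mup_conj // -addnn.
  by rewrite -['X - 1%:P]expr1 mup_XsubCX; case: eqP.
have mupE' x : sg x = x -> mup x ((('X - 1%:P) * ('X - u%:P)) ^+ n * ('X - 0%:P) ^+ n' * (Q * map_poly sg Q))
   = (((if 1%R == x then n else 0) + (if u == x then n else 0)) + (if 0%R == x then n' else 0)
     + (mup x Q).*2)%N.
  move=> sx; rewrite !mupM ?mulf_neq0 ?expf_neq0 ?mulf_neq0 ?XaP ?map_poly_eq0 //.
  by rewrite exprMn mupM ?expf_neq0 ?XaP // !mup_XsubCX mup_conj // -addnn.
have := congr1 (mup 1) E'; rewrite mupE ?mupE' ?rmorph1 // eqxx (negPf u1) eq_sym oner_eq0.
have := congr1 (mup u) E'; rewrite mupE ?mupE' // eqxx [1 == u]eq_sym (negPf u1) [0 == u]eq_sym (negPf u0).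
lia.
Qed.
End Parity.

(** * Construction of the generic point *)

Lemma adjoin_sqrtN1 (K : fieldType) :
  exists (E : fieldType) (h : {rmorphism K -> E}), square (-1 : E).
Proof.
have [sq|nsq] := pselect (square (-1 : K)); first by exists K, idfun.
have sp : size ('X^2 + 1%:P : {poly K}) = 3 by rewrite size_addl ?size_polyXn ?size_polyC ?oner_neq0.
have irr : irreducible_poly ('X^2 + 1%:P : {poly K}).
  apply: cubic_irreducible; first by rewrite sp.
  move=> x; apply/negP; rewrite rootE hornerD hornerXn hornerC addr_eq0 => /eqP e.
  by apply: nsq; exists x.
have [E _ [z pz _]] := irredp_FAdjoin irr; exists E, (in_alg E), z.
move: pz; rewrite rootE polyC1 rmorphD rmorph1 rmorphXn /= map_polyX -polyC1.
by rewrite hornerD hornerXn hornerC addr_eq0 => /eqP.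
Qed.

Lemma lift_polynomials (R : idomainType) (M : fieldType) (i : {rmorphism R -> M}) :
  injective i -> exists i' : {rmorphism {poly R} -> {fraction {poly M}}},
  [/\ injective i', forall c, i' c%:P = cst (i c) & i' 'X = varX M].
Proof.
move=> iI; exists (@tofrac _ \o map_poly i); split=> [p q /= /tofrac_inj|c|] /=.
- by apply: map_inj_poly => //; exact: rmorph0.
- by rewrite map_polyC.
- by rewrite map_polyX.
Qed.

Lemma evaluate_polynomials (R S : comNzRingType) (g : {rmorphism R -> S}) (s : S) :
  exists b : {rmorphism {poly R} -> S}, (forall c, b c%:P = g c) /\ b 'X = s.
Proof.
exists (horner_eval s \o map_poly g); split=> [c|] /=; rewrite /horner_eval.
  by rewrite map_polyC hornerC.
by rewrite map_polyX hornerX.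
Qed.

(* The fraction fields are hidden behind existential quantifiers: unification in
   an iterated fraction field is prohibitively slow. *)
Lemma inversion_extension (M : fieldType) (sg : {rmorphism M -> M}) (N : M) :
  N != 0 -> involutive sg -> sg N = N ->
  exists (Mx : fieldType) (c : {rmorphism M -> Mx}) (x : Mx)
         (tau : {rmorphism Mx -> Mx}),
  [/\ involutive tau, forall a, tau (c a) = c (sg a), tau x = c N / x,
      forall (R : idomainType) (i : {rmorphism R -> M}), injective i ->
        exists i' : {rmorphism {poly R} -> Mx},
          [/\ injective i', forall r, i' r%:P = c (i r) & i' 'X = x]
    & forall a z, a != 0 -> c a = z * tau z ->
        exists b m n, b != 0 /\ a * N ^+ m * (b * sg b) = N ^+ n].
Proof.
move=> N0 sgK sgN; have [tau [tauC tauX]] := extend_inversion sg N0.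
have tauK : involutive tau.
  apply: (@ratfun_rmorph_ext M _ (tau \o tau) idfun) => [a|] /=.
    by rewrite !tauC sgK.
  rewrite tauX fmorph_div tauC sgN tauX invf_div mulrCA divff ?mulr1 //.
  by rewrite fmorph_eq0.
exists {fraction {poly M}}, (@cst M), (varX M), tau; split=> //.
  by move=> R i /lift_polynomials[i' [I C V]]; exists i'; split.
by move=> a z; apply: norm_descent.
Qed.

(** Used with [e = -1] to adjoin x1 and with [e = 1] to adjoin x4. The condition on [e] makes [tau]
    an involution, and [x ^+ 2 != 1] ensures that x1^2 and 1 are distinct points in the parity
    argument. *)
Lemma scaling_extension (M : fieldType) (sg : {rmorphism M -> M}) (e : M) :
  involutive sg -> e * sg e = 1 ->
  exists (Mx : fieldType) (c : {rmorphism M -> Mx}) (x : Mx)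
         (tau : {rmorphism Mx -> Mx}),
  [/\ [/\ involutive tau, forall a, tau (c a) = c (sg a) & tau x = c e * x],
      (forall a, x - c a != 0) /\ x ^+ 2 != 1,
      forall (R : idomainType) (i : {rmorphism R -> M}), injective i ->
        exists i' : {rmorphism {poly R} -> Mx},
          [/\ injective i', forall r, i' r%:P = c (i r) & i' 'X = x]
    & tau x = x -> forall u, u != 0 -> u != 1 -> sg u = u ->
      forall b m m' n n',
      (x - 1) * ((x - 1) * (x - c u)) ^+ m * x ^+ m' * (b * tau b) !=
      ((x - 1) * (x - c u)) ^+ n * x ^+ n'].
Proof.
move=> sgK sge; have e0 : e != 0.
  by apply: contra_eq_neq sge => ->; rewrite mul0r eq_sym oner_eq0.
have [tau [tauC tauX]] := extend_scale sg e0.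
exists {fraction {poly M}}, (@cst M), (varX M), tau; split.
- split=> //; apply: (@ratfun_rmorph_ext M _ (tau \o tau) idfun) => [a|] /=.
    by rewrite !tauC sgK.
  by rewrite tauX rmorphM tauC tauX mulrA -rmorphM mulrC [sg e * e]mulrC sge rmorph1 mulr1.
- split=> [a|]; first by rewrite /varX /= /cst -tofracB tofrac_eq0 polyXsubC_eq0.
  rewrite -subr_eq0 /varX -tofracXn -tofrac1 -tofracB tofrac_eq0 -size_poly_eq0.
  by rewrite -polyC1 size_XnsubC.
- by move=> R i /lift_polynomials[i' [I C V]]; exists i'; split.
by move=> tauX' u u0 u1 su b m m' n n'; apply: (norm_parity tauC tauX' u0 u1 su).
Qed.

Lemma base_extension (E : fieldType) :
  exists (M : fieldType) (c : {rmorphism E -> M}) (x y : M)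
         (tau : {rmorphism M -> M}),
  [/\ [/\ involutive tau, forall a, tau (c a) = c a, tau x = - x & tau y = y],
      [/\ x != 0, y != 0, y - 1 != 0 & y - x ^+ 2 != 0],
      forall (R : idomainType) (i : {rmorphism R -> E}), injective i ->
        exists i' : {rmorphism {poly {poly R}} -> M},
          [/\ injective i', forall r, i' r%:P%:P = c (i r), i' 'X%:P = x & i' 'X = y]
    & forall b m m' n n',
      (y - 1) * ((y - 1) * (y - x ^+ 2)) ^+ m * y ^+ m' * (b * tau b) !=
      ((y - 1) * (y - x ^+ 2)) ^+ n * y ^+ n'].
Proof.
have N1 : -1 * idfun (-1) = 1 :> E by rewrite mulN1r opprK.
have [M0 [c0 [x [s0 [[s0K s0C s0x] [xa x2] lift0 _]]]]] := @scaling_extension E idfun _ (fun=> erefl) N1.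
have one1 : 1 * s0 1 = 1 by rewrite rmorph1 mulr1.
have [M1 [c1 [y [s1 [[s1K s1C s1y] [ya _] lift1 parity]]]]] := scaling_extension s0K one1.
rewrite rmorphN1 mulN1r in s0x; rewrite rmorph1 mul1r in s1y.
have x0 : x != 0 by have := xa 0; rewrite rmorph0 subr0.
exists M1, (c1 \o c0), (c1 x), y, s1; split.
- by split=> [//|a||//] /=; rewrite s1C ?s0C ?s0x ?rmorphN.
- split; first by rewrite fmorph_eq0.
  + by have := ya 0; rewrite rmorph0 subr0.
  + by have := ya 1; rewrite rmorph1.
  + by rewrite -rmorphXn ya.
- move=> R i /lift0[i0 [I0 C0 V0]]; have [i1 [I1 C1 V1]] := lift1 _ i0 I0.
  by exists i1; split=> // [r|]; rewrite C1 ?C0 ?V0.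
rewrite -rmorphXn; apply: parity => //; first by rewrite expf_neq0.
by rewrite rmorphXn s0x sqrrN.
Qed.

Lemma tower (E : fieldType) :
  exists (M : fieldType) (c : {rmorphism E -> M}) (x1 x2 x3 x4 : M)
         (tau : {rmorphism M -> M}),
  [/\ [/\ forall a, tau (c a) = c a, tau x1 = - x1, tau x2 = x4 / x2,
          tau x3 = (x4 - 1) * (x4 - x1 ^+ 2) / x3 & tau x4 = x4],
      [/\ x1 != 0, x4 != 0, x4 - 1 != 0 & x4 - x1 ^+ 2 != 0],
      forall z, x4 - 1 != z * tau z
    & forall (k : fieldType) (i : {rmorphism k -> E}),
      exists eps : {rmorphism ratfun k 4 -> M},
      [/\ forall a, eps (ratC 4 a) = c (i a),
        eps (ratX k (@Ordinal 4 0 isT)) = x1,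
        eps (ratX k (@Ordinal 4 1 isT)) = x2,
        eps (ratX k (@Ordinal 4 2 isT)) = x3
      & eps (ratX k (@Ordinal 4 3 isT)) = x4]].
Proof.
have [M1 [c1 [x [y [s1 [[s1K s1C s1x s1y] [x0 y0 y1 yx] lift1 parity]]]]]] := base_extension E.
have [M2 [c2 [x2 [s2 [s2K s2C s2x lift2 desc2]]]]] := inversion_extension y0 s1K s1y.
set n3 := (y - 1) * (y - x ^+ 2) in parity.
have n30 : n3 != 0 by rewrite mulf_neq0.
have s1n3 : s1 n3 = n3.
  by rewrite /n3 rmorphM !rmorphB rmorph1 rmorphXn s1y s1x sqrrN.
have n30' : c2 n3 != 0 by rewrite fmorph_eq0.
have s2n3 : s2 (c2 n3) = c2 n3 by rewrite s2C s1n3.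
have [M3 [c3 [x3 [s3 [s3K s3C s3x lift3 desc3]]]]] := inversion_extension n30' s2K s2n3.
exists M3, (c3 \o c2 \o c1), (c3 (c2 x)), (c3 x2), x3, (c3 (c2 y)), s3; split.
- split=> [a||||] /=; rewrite ?s3C ?s2C ?s1C ?s1x ?s1y ?s2x ?rmorphN ?fmorph_div //.
  by rewrite s3x /n3 !(rmorphXn, rmorphB, rmorph1, rmorphM).
- by rewrite -!rmorphXn -(rmorph1 (c3 \o c2)) /= -!rmorphB !fmorph_eq0.
- move=> z; apply/negP => /eqP ez.
  have ez' : c3 (c2 (y - 1)) = z * s3 z by rewrite -ez !rmorphB !rmorph1.
  have y1' : c2 (y - 1) != 0 by rewrite fmorph_eq0.
  have [b [m [n [b0 eb]]]] := desc3 _ _ y1' ez'.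
  (* With x3 eliminated, [a] is the element over E(x1, x4) that has become a norm; the second
     descent eliminates x2, and parity applies to the inverse of its witness. *)
  pose a := n3 ^+ n / ((y - 1) * n3 ^+ m).
  have a0 : a != 0 by rewrite mulf_neq0 ?invr_eq0 ?mulf_neq0 ?expf_neq0.
  have ea : c2 a = b * s2 b.
    rewrite /a fmorph_div rmorphM !rmorphXn -eb mulrAC divff ?mul1r //.
    by rewrite mulf_neq0 ?expf_neq0.
  have [b' [m' [n' [b0' eb']]]] := desc2 _ _ a0 ea.
  have /negP := parity b'^-1 m n' n m'; apply; apply/eqP.
  have sb0 : s1 b' != 0 by rewrite fmorph_eq0.
  rewrite fmorphV -eb' /a; field.
  by rewrite ?sb0 ?b0' ?y1 ?expf_neq0.
move=> k i; have [i1 [I1 C1 V1 V1']] := lift1 _ i (fmorph_inj i).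
have [i2 [I2 C2 V2]] := lift2 _ i1 I1; have [i3 [I3 C3 V3]] := lift3 _ i2 I2.
(* The variables are nested in the order of adjunction x1, x4, x2, x3, innermost first. The
   evaluation [b3] back to multivariate polynomials shows that [fwd] is injective. *)
pose T := {poly {poly {poly {poly k}}}}.
pose xs : seq T := [:: 'X%:P%:P%:P; 'X%:P; 'X; 'X%:P%:P].
pose fwd : {rmorphism {mpoly k[4]} -> T} :=
  mmap (polyC \o polyC \o polyC \o polyC) (fun j : 'I_4 => nth 0 xs j).
have fwdC a : fwd a%:MP = a%:P%:P%:P%:P by rewrite /fwd /= mmapC.
have fwdX j : fwd 'X_j = nth 0 xs j by rewrite /fwd /= mmapX mmap1U.
clearbody fwd.
have [b0 [B0 W0]] := @evaluate_polynomials _ _ (@mpolyC 4 k) 'X_(@Ordinal 4 0 isT).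
have [b1 [B1 W1]] := evaluate_polynomials b0 'X_(@Ordinal 4 3 isT).
have [b2 [B2 W2]] := evaluate_polynomials b1 'X_(@Ordinal 4 1 isT).
have [b3 [B3 W3]] := evaluate_polynomials b2 'X_(@Ordinal 4 2 isT).
have fwdK : cancel fwd b3.
  apply: (@mpoly_rmorph_ext _ _ _ (b3 \o fwd) idfun) => [a|j] /=.
    by rewrite fwdC B3 B2 B1 B0.
  rewrite fwdX; case: j => -[|[|[|[|//]]]] lt /=;
    rewrite ?B3 ?B2 ?B1 ?W3 ?W2 ?W1 ?B0 ?W0; congr 'X_[U_(_)]; exact: val_inj.
have epsI : injective (i3 \o fwd) by apply: inj_comp; last exact: can_inj fwdK.
have [eps epsE] := extend_fraction epsI.
by exists eps; split=> [a||||]; rewrite /ratC /ratX epsE /= ?fwdC ?fwdX /=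
  ?C3 ?V3 ?C2 ?V2 ?C1 ?V1 ?V1'.
Qed.

(** * The obstruction *)

(** The components of [y] in the basis 1, [x] over the fixed field are its symmetric and
    antisymmetric parts, so [y = a + x * b] and [tau y = a - x * b]. *)
Lemma fixed_norm (K : fieldType) (tau : {rmorphism K -> K}) (x y : K) :
  2 != 0 :> K -> x != 0 -> tau x = - x -> tau (tau y) = y ->
  exists a b : fixed_field tau,
    y * tau y = val a ^+ 2 - x ^+ 2 * val b ^+ 2.
Proof.
move=> two0 x0 tx ty.
have fa : (y + tau y) / 2 \in fixed_pred tau.
  by apply/eqP; rewrite fmorph_div rmorphD ty rmorph_nat addrC.
have fb : (y - tau y) / (2 * x) \in fixed_pred tau.
  apply/eqP; rewrite fmorph_div rmorphM rmorphB ty rmorph_nat tx.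
  by rewrite mulrN invrN mulrN -mulNr opprB.
exists (FixedField fa), (FixedField fb) => /=.
by field; rewrite ?x0 ?two0.
Qed.

Lemma tower_equivariant (k M : fieldType) (tau : {rmorphism ratfun k 4 -> ratfun k 4})
    (tau' : {rmorphism M -> M}) (eps : {rmorphism ratfun k 4 -> M}) :
  (forall c, tau' (eps (ratC 4 c)) = eps (tau (ratC 4 c))) ->
  (forall i, tau' (eps (ratX k i)) = eps (tau (ratX k i))) ->
  forall z, tau' (eps z) = eps (tau z).
Proof.
move=> eC eX; apply: (@fraction_rmorph_ext _ _ (tau' \o eps) (eps \o tau)) => r.
exact: (@mpoly_rmorph_ext _ _ _ (tau' \o eps \o @tofrac _) (eps \o tau \o @tofrac _)).
Qed.

(* The two points of L joined by a line are [eps], which is generic, and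
   [c \o h0], at which x1^2 becomes a square. *)
Lemma not_retract_rational (k K E M : fieldType) (i : {rmorphism k -> K})
    (tau : {rmorphism K -> K}) (tau_i : forall a, tau (i a) = i a)
    (h0 : {rmorphism K -> E}) (c : {rmorphism E -> M})
    (tau' : {rmorphism M -> M}) (eps : {rmorphism K -> M}) (x1 x2 x3 x4 : K) :
  2 != 0 :> K -> square (-1 : E) -> (forall a, tau' (c a) = c a) ->
  (forall a, eps (i a) = c (h0 (i a))) ->
  (forall z, tau' (eps z) = eps (tau z)) ->
  x1 != 0 -> x2 != 0 -> x3 != 0 -> x4 != 0 -> x4 - 1 != 0 ->
  x4 - x1 ^+ 2 != 0 -> tau x1 = - x1 -> tau x2 = x4 / x2 ->
  tau x3 = (x4 - 1) * (x4 - x1 ^+ 2) / x3 -> tau x4 = x4 ->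
  (forall z, eps x4 - 1 != z * tau' z) -> ~ retract_rational (fixed_const tau_i).
Proof.
move=> two_K sqE tC epsC equiv x10 x20 x30 x40 x41 x4u tx1 tx2 tx3' tx4 nonorm retract.
pose L := fixed_field tau; pose F := fixed_field tau'.
(* Both points take values in the fixed field of [tau']: one by equivariance of [eps], the other
   because [tau'] fixes the image of [c]. *)
have jfix (z : L) : tau' ((eps \o val) z) = (eps \o val) z.
  by rewrite /= equiv; congr (eps _); apply/eqP; exact: (valP z).
have hfix (z : L) : tau' ((c \o h0 \o val) z) = (c \o h0 \o val) z by rewrite /= tC.
pose j : {rmorphism L -> F} := fixed_const jfix.
pose h : {rmorphism L -> F} := fixed_const hfix.
have jh a : j (fixed_const tau_i a) = h (fixed_const tau_i a).
  by apply: val_inj; rewrite /= epsC.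
have [G GE] := retract_line jh retract.
have fu : x1 ^+ 2 \in fixed_pred tau by apply/eqP; rewrite rmorphXn tx1 sqrrN.
have ft : x4 \in fixed_pred tau by apply/eqP; rewrite tx4.
pose u : L := FixedField fu; pose t : L := FixedField ft.
have tt2 : tau (tau x2) = x2.
  by rewrite tx2 fmorph_div tx4 tx2 invf_div mulrCA divff ?mulr1.
have tt3 : tau (tau x3) = x3.
  rewrite tx3' fmorph_div rmorphM !rmorphB rmorph1 rmorphXn tx4 tx1 sqrrN tx3'.
  by rewrite invf_div mulrCA divff ?mulr1 ?mulf_neq0.
have [a [b eab]] := fixed_norm two_K x10 tx1 tt2.
have [d [f edf]] := fixed_norm two_K x10 tx1 tt3.
have [vL vLE] : exists vL : {rmorphism L -> K}, forall z, vL z = val z by exists val.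
have [vF vFE] : exists vF : {rmorphism F -> M}, forall z, vF z = val z by exists val.
have vu : vL u = x1 ^+ 2 by rewrite vLE.
have vt : vL t = x4 by rewrite vLE.
rewrite -!vLE in eab edf.
have {}eab : t = a ^+ 2 - u * b ^+ 2.
  apply: (fmorph_inj vL); rewrite rmorphB [vL (u * _)]rmorphM !rmorphXn vu vt -eab tx2.
  by rewrite mulrCA divff ?mulr1.
have {}edf : (t - 1) * (t - u) = d ^+ 2 - u * f ^+ 2.
  apply: (fmorph_inj vL); rewrite rmorphM !rmorphB [vL (u * _)]rmorphM !rmorphXn.
  by rewrite rmorph1 vu vt -edf tx3' [RHS]mulrCA divff ?mulr1.
have [Nu [Du [Du0 Du1 eU Nu0 Nu1]]] := GE u.
have [Nt [Dt [Dt0 Dt1 eT _ Nt1]]] := GE t.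
have eab' : tofrac Nt / tofrac Dt = G a ^+ 2 - tofrac Nu / tofrac Du * G b ^+ 2.
  by rewrite -eU -eT eab rmorphB [G (u * _)]rmorphM !rmorphXn.
have edf' : (tofrac Nt / tofrac Dt - 1) * (tofrac Nt / tofrac Dt - tofrac Nu / tofrac Du)
    = G d ^+ 2 - tofrac Nu / tofrac Du * G f ^+ 2.
  by rewrite -eU -eT -(rmorph1 G) -!rmorphB -rmorphM edf rmorphB [G (u * _)]rmorphM !rmorphXn.
have fs : c (h0 x1) \in fixed_pred tau' by apply/eqP; rewrite tC.
pose s : F := FixedField fs.
have vs : vF s = c (h0 x1) by rewrite vFE.
have s0 : s != 0 by rewrite -(fmorph_eq0 vF) vs !fmorph_eq0.
have hu : h u = s ^+ 2.
  by apply: (fmorph_inj vF); rewrite rmorphXn vs vFE /= !rmorphXn.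
rewrite hu in Nu0.
have sqF : square (-1 : F).
  have [l el] := sqE; have fl : c l \in fixed_pred tau' by apply/eqP; rewrite tC.
  exists (FixedField fl); apply: (fmorph_inj vF).
  by rewrite rmorphN1 rmorphXn vFE /= -rmorphXn -el rmorphN1.
have two_M : 2 != 0 :> M by rewrite -(rmorph_nat eps) fmorph_eq0.
have two_F : 2 != 0 :> F by rewrite -(fmorph_eq0 vF) rmorph_nat.
have ju0 : j u != 0 by rewrite fmorph_eq0 -(fmorph_eq0 vL) vu expf_neq0.
have jt0 : j t != 0 by rewrite fmorph_eq0 -(fmorph_eq0 vL) vt.
have jt1 : j t != 1.
  by rewrite -(rmorph1 j) (inj_eq (fmorph_inj j)) -subr_eq0 -(fmorph_eq0 vL) rmorphB rmorph1 vt.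
have jtu : j t != j u.
  by rewrite (inj_eq (fmorph_inj j)) -subr_eq0 -(fmorph_eq0 vL) rmorphB vt vu.
set y1 := eps x1; have y10 : y1 != 0 by rewrite fmorph_eq0.
have t1 : tau' y1 = - y1 by rewrite equiv tx1 rmorphN.
have vju : vF (j u) = y1 ^+ 2 by rewrite vFE /= rmorphXn.
have vjt : vF (j t) = eps x4 by rewrite vFE.
have vfix (z : F) : tau' (vF z) = vF z by rewrite vFE; apply/eqP; exact: (valP z).
have [[r er]|[x [y exy]]] := norm_along_line sqF two_F eab' edf' Du0 Dt0 Du1 Dt1 s0 Nu0 Nu1 Nt1 ju0 jt0 jt1 jtu.
  (* A square root of [j u] in [F] would be [y1] up to sign, but [tau'] negates [y1] and the
     characteristic is not 2. *)
  have : y1 ^+ 2 == vF r ^+ 2 by rewrite -vju er rmorphXn.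
  rewrite eqf_sqr => /orP ry; have ty : tau' y1 = y1.
    by case: ry => /eqP ->; rewrite ?rmorphN vfix.
  move/eqP: ty; rewrite t1 eq_sym -addr_eq0 -mulr2n -mulr_natl mulf_eq0.
  by rewrite (negPf two_M) (negPf y10).
(* As [tau'] negates [y1], this element has norm [x ^+ 2 - j u * y ^+ 2], which is [j t - 1]. *)
have /negP := nonorm (vF x + vF y * y1); apply; apply/eqP.
rewrite rmorphD rmorphM !vfix t1.
have := congr1 vF exy; rewrite !rmorphB [vF (j u * _)]rmorphM !rmorphXn rmorph1 vju vjt => ->.
by ring.
Qed.

Theorem theorem6p3 (k : fieldType)
  (k_infinite : infinite_set [set: k]%classic)
  (k_char : 2%N \notin [pchar k])
  (tau : {rmorphism ratfun k 4 -> ratfun k 4})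
  (tau_k : forall c : k, tau (ratC 4 c) = ratC 4 c) :
  let x1 : ratfun k 4 := ratX k (@Ordinal 4 0 isT) in
  let x2 : ratfun k 4 := ratX k (@Ordinal 4 1 isT) in
  let x3 : ratfun k 4 := ratX k (@Ordinal 4 2 isT) in
  let x4 : ratfun k 4 := ratX k (@Ordinal 4 3 isT) in
  tau x1 = - x1 ->
  tau x2 = x4 / x2 ->
  tau x3 = (- (x4 - 1) * x1 ^+ 2 + x4 * (x4 - 1)) / x3 ->
  tau x4 = x4 ->
  ~ retract_rational (fixed_const tau_k).
Proof.
move=> x1 x2 x3 x4 tx1 tx2 tx3 tx4 retract.
have two_k : 2 != 0 :> k by move: k_char; rewrite inE.
have two_K : 2 != 0 :> ratfun k 4 by rewrite -(rmorph_nat (@ratC k 4)) fmorph_eq0.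
have Xneq0 i : ratX k i != 0 :> ratfun k 4.
  by rewrite tofrac_eq0; apply/eqP => /(congr1 (mcoeff U_(i))) /eqP;
     rewrite mcoeffX eqxx mcoeff0 oner_eq0.
(* [E] extends the whole field k(x1, ..., x4), so [h0] is itself a point with values in the
   constants of the tower over [E]; [eps] sends the variables to new ones. *)
have [E [h0 sqE]] := adjoin_sqrtN1 (ratfun k 4).
have [M [c [y1 [y2 [y3 [y4 [tau' [[tC t1 t2 t3 t4] [y10 y40 y41 y4u] nonorm emb]]]]]]]] := tower E.
have [eps [epsC e1 e2 e3 e4]] := emb k (h0 \o @ratC k 4).
rewrite -/x1 in e1; rewrite -/x2 in e2; rewrite -/x3 in e3; rewrite -/x4 in e4.
have equiv z : tau' (eps z) = eps (tau z).
  have q1 : tau' (eps x1) = eps (tau x1) by rewrite tx1 rmorphN e1.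
  have q2 : tau' (eps x2) = eps (tau x2) by rewrite tx2 fmorph_div e2 e4.
  have q3 : tau' (eps x3) = eps (tau x3).
    rewrite tx3 fmorph_div e3 t3; congr (_ / _).
    rewrite !(rmorphXn, rmorphD, rmorphN, rmorph1, rmorphM) e1 e4; ring.
  have q4 : tau' (eps x4) = eps (tau x4) by rewrite tx4 e4.
  move: z; apply: tower_equivariant => [a|i]; first by rewrite tau_k epsC tC.
  case: i => -[|[|[|[|//]]]] lt.
  - by rewrite (_ : Ordinal lt = @Ordinal 4 0 isT); [exact: q1|exact: val_inj].
  - by rewrite (_ : Ordinal lt = @Ordinal 4 1 isT); [exact: q2|exact: val_inj].
  - by rewrite (_ : Ordinal lt = @Ordinal 4 2 isT); [exact: q3|exact: val_inj].
  - by rewrite (_ : Ordinal lt = @Ordinal 4 3 isT); [exact: q4|exact: val_inj].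
have x41 : x4 - 1 != 0 by rewrite -(fmorph_eq0 eps) rmorphB rmorph1 e4.
have x4u : x4 - x1 ^+ 2 != 0 by rewrite -(fmorph_eq0 eps) rmorphB rmorphXn e1 e4.
have tx3' : tau x3 = (x4 - 1) * (x4 - x1 ^+ 2) / x3.
  have id (R : comNzRingType) (a b : R) :
      - (b - 1) * a ^+ 2 + b * (b - 1) = (b - 1) * (b - a ^+ 2) by ring.
  by rewrite tx3 id.
have nonorm' z : eps x4 - 1 != z * tau' z by rewrite e4; exact: nonorm.
exact: (@not_retract_rational k (ratfun k 4) E M (@ratC k 4) tau tau_k h0 c tau'
  eps x1 x2 x3 x4 two_K sqE tC epsC equiv (Xneq0 _) (Xneq0 _) (Xneq0 _)
  (Xneq0 _) x41 x4u tx1 tx2 tx3' tx4 nonorm' retract).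
Qed.
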